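(* Let $M$ be an oriented closed connected manifold with infinite fundamental group $\Gamma$ and let $B$ be a non-trivial standard Borel probability space. Then $$\boldsymbol{|}M\boldsymbol{|}^\alpha\le\boldsymbol{|}M\boldsymbol{|}^{B^\Gamma}$$ holds for all free standard $\Gamma$-spaces $\alpha$.
   Context: Let $M$ be an oriented closed connected $n$-manifold with fundamental group $\Gamma$ and universal covering $\pi:\widetilde M\to M$. A standard $\Gamma$-space $\alpha=\Gamma\curvearrowright(X,\mu)$ is a standard Borel probability space with a measurable $\mu$-preserving left $\Gamma$-action; the action of $g$ is denoted $g^\alpha$. It is called free if the action is free on a subset of full measure (essentially free). For a standard Borel probability space $B$, the Bernoulli shift $B^\Gamma$ of $\Gamma$ with base $B$ is the standard Borel space $B^\Gamma$ with the product probability measure and the left translation action of $\Gamma$. Here $B$ is non-trivial if its probability measure is not concentrated on a single point. Equip $L^\infty(X,\mu,\mathbb Z)$ (essentially bounded measurable $\mathbb Z$-valued functions modulo a.e. equality) with the right $\Gamma$-action $(f\cdot g)(x)=f(g^\alpha(x))$, and set $C_*(M;\alpha)=L^\infty(X,\mu,\mathbb Z)\otimes_{\mathbb Z\Gamma}C_*(\widetilde M;\mathbb Z)$ (singular chains, $\Gamma$ acting by deck transformations). The inclusion of $\mathbb Z$ as constant functions induces a chain map $C_*(M;\mathbb Z)\cong\mathbb Z\otimes_{\mathbb Z\Gamma}C_*(\widetilde M;\mathbb Z)\to C_*(M;\alpha)$; cycles representing the image of the integral fundamental class $[M]_{\mathbb Z}$ in $H_n(C_*(M;\alpha))$ are $\alpha$-parametrized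 fundamental cycles. For a chain $c=\sum_{j=1}^k f_j\otimes\sigma_j$ in reduced form (i.e. $\pi\circ\sigma_j\ne\pi\circ\sigma_l$ for $j\neq l$) put $\boldsymbol{|}c\boldsymbol{|}^\alpha=\sum_{j=1}^k\int_X|f_j|\,d\mu$. Then $\boldsymbol{|}M\boldsymbol{|}^\alpha$ is the infimum of $\boldsymbol{|}c\boldsymbol{|}^\alpha$ over all $\alpha$-parametrized fundamental cycles. *)

(* Defs.v *)
From HB Require Import structures.
From mathcomp.multinomials Require Import freeg.
From mathcomp Require Import all_boot all_order all_algebra.
From mathcomp Require Import generic_quotient ring_quotient.
From mathcomp Require Import all_classical all_reals all_analysis.
From mathcomp Require Import wedge_sigT continuous_path.

Set Implicit Arguments.
Unset Strict Implicit.
Unset Printing Implicit Defensive.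

Import Order.TTheory GRing.Theory Num.Theory numFieldNormedType.Exports.

Local Open Scope classical_set_scope.
Local Open Scope ring_scope.
Local Open Scope quotient_scope.

Section GeneratedSubgroup.
Variables (V : zmodType) (S : set V).

Definition subgroup (H : set V) := H 0 /\ forall x y, H x -> H y -> H (x - y).

Definition gen_subgroup : set V :=
  [set x | forall H : set V, subgroup H -> S `<=` H -> H x].

Definition gen_pred (x : V) : bool := `[< gen_subgroup x >].

Lemma gen_pred_closed : zmod_closed gen_pred.
Proof.
split; first by apply/asboolP => H [].
move=> x y /asboolP Hx /asboolP Hy; apply/asboolP => H sH SH.
by apply: sH.2; [exact: Hx|exact: Hy].
Qed.

HB.instance Definition _ := GRing.isZmodClosed.Build V gen_pred gen_pred_closed.

Definition gen_zmodClosed : zmodClosed V := GRing.ZmodClosed.clone V gen_pred _.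

End GeneratedSubgroup.

Lemma quot_piB (V : zmodType) (I : zmodClosed V) :
  {morph \pi_(Quotient.quot I) : x y / x - y}.
Proof. by move=> x y; rewrite !piE. Qed.

(** A right (left) [ZZ[Gam]]-module is an abelian group with a right (left)
    additive action of [Gam]; the tensor product over [ZZ[Gam]] is the free
    abelian group on pairs modulo biadditivity and the balancing relation. *)
Section Tensor.
Variables (Gam : Type) (A C : zmodType).
Variables (ract : A -> Gam -> A) (lact : Gam -> C -> C).

Definition tensor_relations : set {freeg (A * C)%type} :=
  [set t | exists a a' c, t = << (a + a', c) >> - << (a, c) >> - << (a', c) >>]
  `|`
  [set t | exists a c c', t = << (a, c + c') >> - << (a, c) >> - << (a, c') >>]
  `|`
  [set t | exists a g c, t = << (ract a g, c) >> - << (a, lact g c) >>].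

Definition tensor := Quotient.quot (gen_zmodClosed tensor_relations).
HB.instance Definition _ := EqQuotient.on tensor.
HB.instance Definition _ := GRing.Zmodule.on tensor.

Definition tens (a : A) (c : C) : tensor :=
  \pi_(Quotient.quot (gen_zmodClosed tensor_relations)) << (a, c) >>.

End Tensor.

Section TensorMap.
Variables (Gam : Type) (A C C' : zmodType).
Variables (ract : A -> Gam -> A).
Variables (lact : Gam -> C -> C) (lact' : Gam -> C' -> C').
Variable (h : C -> C').


Definition tensor_map_raw : {freeg (A * C)%type} -> {freeg (A * C')%type} :=
  fglift (fun k : A * C => << (k.1, h k.2) >>).

(** [id (x) h], meaningful when [h] is additive and equivariant. *)
Definition tensor_map (t : tensor ract lact) : tensor ract lact' :=
  \pi_(tensor ract lact') (tensor_map_raw (repr t)).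

Hypothesis hD : {morph h : x y / x + y}.
Hypothesis hE : forall g x, h (lact g x) = lact' g (h x).

Let raw_add : additive tensor_map_raw. Proof. exact: lift_is_additive. Qed.

Let raw1 a c : tensor_map_raw << (a, c) >> = << (a, h c) >>.
Proof. by rewrite /tensor_map_raw liftU scale1r. Qed.

Lemma tensor_map_pi (x : {freeg (A * C)%type}) :
  tensor_map (\pi_(tensor ract lact) x) =
  \pi_(tensor ract lact') (tensor_map_raw x).
Proof.
apply/eqP; rewrite -[_ == _]Quotient.idealrBE -raw_add.
have : repr (\pi_(tensor ract lact) x) - x
    \in gen_zmodClosed (tensor_relations ract lact).
  by rewrite Quotient.idealrBE reprK.
move: (_ - x) => y /asboolP yS; apply/asboolP => H [H0 HB] HS.
have raw0 : tensor_map_raw 0 = 0 by rewrite -[0](subrr 0) raw_add !subrr.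
apply: (yS [set z | H (tensor_map_raw z)]).
  split=> [|u v Hu Hv] /=; first by rewrite raw0.
  by rewrite raw_add; exact: HB.
move=> z [[]|] [a [b [c ->]]] /=; rewrite !raw_add !raw1; apply: HS.
- by left; left; exists a, b, (h c).
- by left; right; exists a, (h b), (h c); rewrite hD.
- by right; exists a, b, (h c); rewrite hE.
Qed.

Lemma tensor_mapE a c : tensor_map (tens ract lact a c) = tens ract lact' a (h c).
Proof. by rewrite /tens tensor_map_pi raw1. Qed.

Lemma tensor_mapB : {morph tensor_map : x y / x - y}.
Proof.
move=> x y; rewrite -[x]reprK -[y]reprK.
rewrite -[repr x]/(repr (x : Quotient.quot _)).
by rewrite -quot_piB tensor_map_pi raw_add quot_piB -!tensor_map_pi.
Qed.

End TensorMap.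

Section Simplices.
Variable R : realType.

Definition stdsimplex (k : nat) : set 'rV[R]_k.+1 :=
  [set t | (forall i, 0 <= t 0 i) /\ \sum_i t 0 i = 1].

(** The type of points of the standard simplex, with the subspace topology, so
    that singular simplices are equal as soon as they agree on the simplex. *)
Definition Delta (k : nat) : topologicalType := set_type (@stdsimplex k).

Definition face_row (k : nat) (i : 'I_k.+2) (t : 'rV[R]_k.+1) : 'rV[R]_k.+2 :=
  \row_j (if unlift i j is Some j' then t 0 j' else 0).

Lemma face_row_stdsimplex k (i : 'I_k.+2) t :
  stdsimplex t -> stdsimplex (face_row i t).
Proof.
move=> [t0 t1]; split=> [j|].
  by rewrite mxE; case: unlift => [j'|//]; exact: t0.
rewrite (bigD1_ord i) //= mxE unlift_none add0r -t1.
by apply: eq_bigr => j _; rewrite mxE liftK.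
Qed.

Lemma face_row_continuous k (i : 'I_k.+2) : continuous (face_row i).
Proof.
move=> t A [B tB BA]; pose C (_ : 'I_1) (j' : 'I_k.+1) := B 0 (lift i j').
exists C.
  move=> i0 j'; have := tB 0 (lift i j').
  by rewrite mxE liftK (ord1 i0).
move=> s sC; apply: BA => i0 j; rewrite (ord1 i0) mxE.
case: unliftP => [j' ->|ji]; first exact: sC.
by have := tB 0 j; rewrite mxE ji unlift_none => /nbhs_singleton.
Qed.

Definition face (k : nat) (i : 'I_k.+2) (t : Delta k) : Delta k.+1 :=
  exist _ (face_row i (val t)) (mem_set (face_row_stdsimplex i (set_mem (valP t)))).

Lemma face_continuous k (i : 'I_k.+2) : continuous (@face k i).
Proof.
apply: continuous_comp_initial => t.
apply: (@continuous_comp _ _ _ (fun x : Delta k => val x) (face_row i)).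
  exact: initial_continuous.
exact: face_row_continuous.
Qed.

HB.instance Definition _ k (i : 'I_k.+2) :=
  isContinuous.Build (Delta k) (Delta k.+1) (face i) (@face_continuous k i).

Definition simplex (k : nat) (X : topologicalType) := continuousType (Delta k) X.

Definition push (k : nat) (X Y : topologicalType) (f : continuousType X Y)
    (s : simplex k X) : simplex k Y :=
  [the continuousType (Delta k) Y of f \o s].

Definition dface (k : nat) (X : topologicalType) (i : 'I_k.+2)
    (s : simplex k.+1 X) : simplex k X :=
  [the continuousType (Delta k) X of s \o face i].

End Simplices.

Section Chains.
Variable R : realType.

Definition chain (k : nat) (X : topologicalType) := {freeg (simplex R k X)}.

Definition chain_map (k : nat) (X Y : topologicalType) (f : continuousType X Y) :
    chain k X -> chain k Y :=
  fglift (fun s => << push f s >>).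

Definition boundary_succ (k : nat) (X : topologicalType) :
    chain k.+1 X -> chain k X :=
  fglift (fun s => \sum_(i < k.+2) << (-1) ^+ i *g dface i s >>).

Definition boundary (k : nat) (X : topologicalType) :
    chain k X -> chain k.-1 X :=
  match k with 0%N => fun=> 0 | k'.+1 => @boundary_succ k' X end.

HB.instance Definition _ k (X Y : topologicalType) (f : continuousType X Y) :=
  GRing.isZmodMorphism.Build (chain k X) (chain k Y) (@chain_map k X Y f)
    (lift_is_additive _).
HB.instance Definition _ k (X : topologicalType) :=
  GRing.isZmodMorphism.Build (chain k.+1 X) (chain k X) (@boundary_succ k X)
    (lift_is_additive _).

Lemma boundary_is_additive k (X : topologicalType) : additive (@boundary k X).
Proof.
case: k => [|k] c c'; first by rewrite /= subrr.
exact: (raddfB (@boundary_succ k X)).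
Qed.

HB.instance Definition _ k (X : topologicalType) :=
  GRing.isZmodMorphism.Build (chain k X) (chain k.-1 X) (@boundary k X)
    (@boundary_is_additive k X).

Lemma freeg_additive_ext (K : choiceType) (V : zmodType)
    (f g : {additive {freeg K} -> V}) :
  (forall s, f << s >> = g << s >>) -> f =1 g.
Proof.
move=> fg c; rewrite -(freeg_sumE c) !raddf_sum; apply: eq_bigr => s _.
rewrite (_ : << _ *g s >> = << s >> *~ coeff s c); last by rewrite freeg_mulz intz.
by rewrite !raddfMz fg.
Qed.

Lemma chain_mapU k (X Y : topologicalType) (f : continuousType X Y) (s : simplex R k X) :
  chain_map f << s >> = << push f s >>.
Proof. by rewrite /chain_map liftU scale1r. Qed.

Lemma boundaryU k (X : topologicalType) (s : simplex R k.+1 X) :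
  boundary << s >> = \sum_(i < k.+2) << (-1) ^+ i *g dface i s >>.
Proof. by rewrite /= /boundary_succ liftU scale1r. Qed.

Lemma chain_map_boundary k (X Y : topologicalType) (f : continuousType X Y) (c : chain k X) :
  boundary (chain_map f c) = chain_map f (boundary c).
Proof.
case: k c => [|k] c; first by rewrite /= raddf0.
pose F : {additive chain k.+1 X -> chain k Y} := @boundary k.+1 Y \o chain_map f.
pose G : {additive chain k.+1 X -> chain k Y} := chain_map f \o @boundary k.+1 X.
apply: (@freeg_additive_ext _ _ F G) => s.
rewrite /F /G [LHS]/= [RHS]/= chain_mapU.
rewrite -[LHS]/(boundary << _ >>) -[boundary_succ _]/(boundary << _ >>).
rewrite !boundaryU raddf_sum; apply: eq_bigr => i _.
rewrite -[RHS]/(fglift _ _) liftU; apply/eqP/freeg_eqP => x; rewrite coeffZ !coeffU.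
rewrite mul1r; congr (_ * (_ == x)%:R).
by apply/continuousEP.
Qed.

Definition supported (k : nat) (X : topologicalType) (A : set X) (c : chain k X) :=
  forall s, s \in dom c -> range s `<=` A.

(** Relative cycles and relative homology of the pair [(X, X \ A)]. *)
Definition rel_cycle k (X : topologicalType) (A : set X) (c : chain k X) :=
  supported (~` A) (boundary c).

Definition rel_homologous k (X : topologicalType) (A : set X) (c c' : chain k X) :=
  exists (b : chain k.+1 X) (e : chain k X),
    supported (~` A) e /\ c - c' = boundary b + e.

End Chains.

Section Manifolds.
Variables (R : realType) (n : nat) (M : topologicalType).

Definition locally_euclidean := forall x : M,
  exists (U : set M) (V : set 'rV[R]_n) (f : M -> 'rV[R]_n) (g : 'rV[R]_n -> M),
    [/\ open_nbhs x U, open V, {within U, continuous f} & {within V, continuous g}]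
    /\ [/\ f @` U `<=` V, g @` V `<=` U, {in U, cancel f g} & {in V, cancel g f}].

Definition closed_connected_manifold :=
  [/\ hausdorff_space M, @second_countable M, locally_euclidean,
      compact [set: M] & connected [set: M]].

(** A locally consistent choice of generators of [H_n(M, M \ {x}; ZZ)]. *)
Record orientation := Orientation {
  local_class : M -> chain R n M;
  local_class_cycle : forall x, rel_cycle [set x] (local_class x);
  local_class_generator : forall x (c : chain R n M), rel_cycle [set x] c ->
    exists m : int, rel_homologous [set x] c (local_class x *~ m);
  local_class_consistent : forall x, exists (U : set M) (c : chain R n M),
    [/\ open_nbhs x U, rel_cycle U c
      & forall y, U y -> rel_homologous [set y] c (local_class y)]
}.

(** Cycles representing the integral fundamental class of [(M, o)]. *)
Definition fundamental_cycle (o : orientation) (z : chain R n M) :=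
  boundary z = 0 /\ forall x, rel_homologous [set x] z (local_class o x).

End Manifolds.

Section FundamentalGroup.
Variable R : realType.

Definition unit_itv : Type := set_type `[(0 : R), 1]%classic.
HB.instance Definition _ := Topological.on unit_itv.

Definition clamp_val (s : R) : R := Num.max 0 (Num.min 1 s).

Lemma clamp_subproof (s : R) : clamp_val s \in `[(0 : R), 1]%classic.
Proof.
by rewrite inE /= in_itv /= /clamp_val le_max lexx ge_max ler01 ge_min lexx.
Qed.

Definition clamp (s : R) : unit_itv := exist _ (clamp_val s) (clamp_subproof s).

Lemma clamp01 : clamp 0 != clamp 1.
Proof.
apply/eqP => /(congr1 val); rewrite /= /clamp_val minxx.
by rewrite (min_idPr ler01) maxxx (max_idPr ler01) => /eqP; rewrite eq_sym oner_eq0.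
Qed.

HB.instance Definition _ := isBiPointed.Build unit_itv clamp01.

Lemma clamp_continuous : continuous clamp.
Proof.
apply: continuous_comp_initial.
have c1 : continuous ((cst 1 : R -> R^o) \min id).
  by move=> s; apply: continuous_min; [exact: cst_continuous|].
have c0 : continuous ((cst 0 : R -> R^o) \max ((cst 1 : R -> R^o) \min id)).
  by move=> s; apply: continuous_max; [exact: cst_continuous|exact: c1].
exact: c0.
Qed.

Variable X : topologicalType.


Definition concat_fun (p q : unit_itv -> X) (t : unit_itv) : X :=
  if val t <= 2^-1 then p (clamp (2 * val t)) else q (clamp (2 * val t - 1)).

Section Concat.
Variables (x y z : X).
Variables (p : {path unit_itv from x to y}) (q : {path unit_itv from y to z}).

Lemma concat_continuous : continuous (concat_fun p q).
Proof.
have cv : continuous (val : unit_itv -> R) by exact: initial_continuous.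
pose F (t : unit_itv) := p (clamp (2 * val t)).
pose G (t : unit_itv) := q (clamp (2 * val t - 1)).
have c2 : continuous (fun t : unit_itv => 2 * val t).
  move=> t; apply: (@continuous_comp _ _ _ (fun t : unit_itv => val t) ( *%R 2)).
    exact: cv.
  exact: mulrl_continuous.
have cF : continuous F.
  have c : continuous (clamp \o (fun t : unit_itv => 2 * val t)).
    move=> t; apply: continuous_comp; first exact: c2.
    exact: clamp_continuous.
  have -> : F = p \o (clamp \o (fun t : unit_itv => 2 * val t)) by [].
  by move=> t; apply: continuous_comp; [exact: c|exact: cts_fun].
have cG : continuous G.
  have c3 : continuous (fun t : unit_itv => 2 * val t - 1).
    by move=> t; apply: (cvgB (c2 t)); exact: cvg_cst.
  have c : continuous (clamp \o (fun t : unit_itv => 2 * val t - 1)).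
    move=> t; apply: continuous_comp; first exact: c3.
    exact: clamp_continuous.
  have -> : G = q \o (clamp \o (fun t : unit_itv => 2 * val t - 1)) by [].
  by move=> t; apply: continuous_comp; [exact: c|exact: cts_fun].
move=> t; have [tlt|tgt|teq] := ltgtP (val t) 2^-1.
- have near_lt : \forall s \near t, val s < 2^-1.
    exact: (cv t _ (lt_nbhsl tlt)).
  rewrite /continuous_at; have -> : concat_fun p q t = F t by rewrite /concat_fun (ltW tlt).
  move=> U /(cF t) FU.
  change (\forall s \near t, U (concat_fun p q s)); near=> s.
  rewrite /= /concat_fun ifT; first by near: s.
  by apply: ltW; near: s.
- have near_gt : \forall s \near t, 2^-1 < val s.
    exact: (cv t _ (lt_nbhsr tgt)).
  rewrite /continuous_at; have -> : concat_fun p q t = G t by rewrite /concat_fun leNgt tgt.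
  move=> U /(cG t) GU.
  change (\forall s \near t, U (concat_fun p q s)); near=> s.
  rewrite /= /concat_fun ifF; first by near: s.
  by apply/negbTE; rewrite -ltNge; near: s.
have FG : F t = G t.
  rewrite /F /G teq divff // subrr.
  by rewrite -/(@one unit_itv) -/(@zero unit_itv) path_one path_zero.
rewrite /continuous_at; have -> : concat_fun p q t = F t by rewrite /concat_fun ifT // teq.
move=> U FU; have GU : \forall s \near t, U (G s) by apply: (cG t); rewrite -FG.
have {}FU : \forall s \near t, U (F s) by exact: (cF t).
change (\forall s \near t, U (concat_fun p q s)).
by apply: filterS2 FU GU => s Fs Gs; rewrite /concat_fun; case: ifP.
Unshelve. all: by end_near. Qed.

Let val0 : val (zero : unit_itv) = 0.
Proof. by rewrite /= /clamp_val (min_idPr ler01) maxxx. Qed.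

Let val1 : val (one : unit_itv) = 1.
Proof. by rewrite /= /clamp_val minxx (max_idPr ler01). Qed.

Lemma concat_zero : concat_fun p q zero = x.
Proof. by rewrite /concat_fun val0 mulr0 invr_ge0 ler0n path_zero. Qed.

Lemma concat_one : concat_fun p q one = z.
Proof.
rewrite /concat_fun val1 ifF; last first.
  by apply/negbTE; rewrite -ltNge invf_lt1 ?ltr1n ?ltr0n.
by rewrite mulr1 -[2]/(1 + 1) addrK path_one.
Qed.

HB.instance Definition _ :=
  isContinuous.Build unit_itv X (concat_fun p q) concat_continuous.
HB.instance Definition _ :=
  isPath.Build unit_itv X x z (concat_fun p q) concat_zero concat_one.

Definition concat : {path unit_itv from x to z} :=
  [the {path unit_itv from x to z} of concat_fun p q].

End Concat.

Definition homotopic (x y : X) (p q : {path unit_itv from x to y}) :=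
  exists H : unit_itv * unit_itv -> X, continuous H /\
    [/\ forall t, H (t, zero) = p t, forall t, H (t, one) = q t,
        forall s, H (zero, s) = x & forall s, H (one, s) = y].

Definition cst_loop (x : X) : {path unit_itv from x to x} :=
  [the {path unit_itv from x to x} of cst x].

Definition simply_connected :=
  (forall x y : X, inhabited {path unit_itv from x to y}) /\
  (forall (x : X) (p : {path unit_itv from x to x}), homotopic p (cst_loop x)).

(** [cls] identifies the group [Gam] with the fundamental group of [X] at [x0]:
    it induces a group isomorphism from homotopy classes of loops to [Gam]. *)
Definition is_fundamental_group (x0 : X) (Gam : groupType)
    (cls : {path unit_itv from x0 to x0} -> Gam) :=
  [/\ forall g, exists p, cls p = g,
      forall p q, cls p = cls q <-> homotopic p q
    & forall p q, cls (concat p q) = (cls p * cls q)%g].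

End FundamentalGroup.

Section Coverings.
Variables (R : realType) (Mt M : topologicalType).

Definition covering_map (p : Mt -> M) :=
  [/\ continuous p, set_surj [set: Mt] [set: M] p
    & forall x : M, exists (U : set M) (I : Type) (V : I -> set Mt),
      [/\ open_nbhs x U, trivIset [set: I] V, p @^-1` U = \bigcup_i V i
        & forall i, open (V i) /\
          exists s : M -> Mt, [/\ {within U, continuous s}, s @` U `<=` V i,
            {in U, cancel s p} & {in V i, cancel p s}]]].

Definition universal_covering (p : Mt -> M) :=
  covering_map p /\ simply_connected R Mt.

(** The left action of the fundamental group by deck transformations for the
    base point [y0]: [deck (cls l)] moves [y0] to the endpoint of the lift of the
    loop [l] starting at [y0]. *)
Definition deck_action (p : Mt -> M) (y0 : Mt) (Gam : groupType)
    (cls : {path (unit_itv R) from (p y0) to (p y0)} -> Gam)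
    (deck : Gam -> continuousType Mt Mt) :=
  [/\ forall y, deck 1%g y = y,
      forall g h y, deck (g * h)%g y = deck g (deck h y),
      forall g y, p (deck g y) = p y
    & forall (l : {path (unit_itv R) from (p y0) to (p y0)})
        (m : continuousType (unit_itv R) Mt),
        (forall t, p (m t) = l t) -> m zero = y0 -> m one = deck (cls l) y0].

End Coverings.

Section Linf.
Context (R : realType) (d : measure_display) (X : measurableType d).
Variable mu : probability X R.

Definition ess_bounded_pred (f : X -> int) : bool :=
  `[< (forall A : set int, measurable (f @^-1` A)) /\
      exists K : nat, \forall x \ae mu, (`|f x| <= K)%N >].

Lemma ess_bounded_closed : zmod_closed ess_bounded_pred.
Proof.
split.
  apply/asboolP; split=> [A|]; last by exists 0%N; apply: filterE => x.
  have [A0|A0] := pselect (A 0).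
    by rewrite (_ : _ @^-1` _ = setT)//; apply/seteqP; split.
  by rewrite (_ : _ @^-1` _ = set0)//; apply/seteqP; split.
move=> f g /asboolP[mf [K fK]] /asboolP[mg [L gL]]; apply/asboolP; split=> [A|].
  rewrite (_ : _ @^-1` A =
    \bigcup_(z : int) (f @^-1` [set z] `&` g @^-1` [set w | A (z - w)])).
    apply: countable_bigcupT_measurable => [|z]; first exact: countableP.
    by apply: measurableI; [exact: mf|exact: mg].
  apply/seteqP; split=> [x Ax|x [z _ [/= <-]]//].
  by exists (f x).
exists (K + L)%N; apply: filterS2 fK gL => x fK gL.
rewrite -[leqLHS]/(`|f x - g x|)%N.
by rewrite (leq_trans (leqD_dist _ 0 _))// sub0r subr0 abszN leq_add.
Qed.

HB.instance Definition _ :=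
  GRing.isZmodClosed.Build (X -> int) ess_bounded_pred ess_bounded_closed.

Definition ess_bounded := {f : X -> int | ess_bounded_pred f}.
HB.instance Definition _ := Choice.on ess_bounded.
HB.instance Definition _ := SubType.on ess_bounded.
HB.instance Definition _ := [SubChoice_isSubZmodule of ess_bounded by <:].

Definition ae_zero (f : ess_bounded) : bool := `[< \forall x \ae mu, val f x = 0 >].

Lemma ae_zero_closed : zmod_closed ae_zero.
Proof.
split; first by apply/asboolP/filterE => x; rewrite raddf0.
move=> f g /asboolP f0 /asboolP g0; apply/asboolP.
apply: filterS2 f0 g0 => x f0 g0; rewrite raddfB.
by rewrite -[LHS]/(val f x - val g x) f0 g0 subrr.
Qed.

HB.instance Definition _ :=
  GRing.isZmodClosed.Build ess_bounded ae_zero ae_zero_closed.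

(** [L^oo(X, mu, ZZ)] *)
Definition Linf := Quotient.quot (GRing.ZmodClosed.clone ess_bounded ae_zero _).
HB.instance Definition _ := EqQuotient.on Linf.
HB.instance Definition _ := GRing.Zmodule.on Linf.

Definition integral_abs (f : Linf) : \bar R :=
  (\int[mu]_x (`|val (repr f : ess_bounded) x|%N%:R)%:E)%E.

Lemma ess_bounded_one : ess_bounded_pred (cst 1).
Proof.
apply/asboolP; split=> [A|]; last by exists 1%N; apply: filterE => x.
have [A0|A0] := pselect (A 1).
  by rewrite (_ : _ @^-1` _ = setT)//; apply/seteqP; split.
by rewrite (_ : _ @^-1` _ = set0)//; apply/seteqP; split.
Qed.

Definition Linf_one : Linf := \pi_Linf (exist _ (cst 1) ess_bounded_one).

End Linf.

Section GammaSpaces.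
Variables (R : realType) (Gam : groupType).

(** Measurable measure-preserving left actions of the discrete group [Gam]. *)
Record gamma_space (d : measure_display) (X : measurableType d)
    (mu : probability X R) := GammaSpace {
  gact :> Gam -> X -> X;
  gact1 : forall x, gact 1%g x = x;
  gactM : forall g h x, gact (g * h)%g x = gact g (gact h x);
  gact_measurable : forall g, measurable_fun setT (gact g);
  gact_preserving : forall g A, measurable A -> mu (gact g @^-1` A) = mu A
}.

Section Action.
Context (d : measure_display) (X : measurableType d).
Variables (mu : probability X R) (alpha : gamma_space mu).

Definition essentially_free := exists A : set X,
  [/\ measurable A, mu A = 1%E, forall g x, A x -> A (alpha g x)
    & forall g x, A x -> alpha g x = x -> g = 1%g].

Lemma ae_gact (P : set X) g :
  (\forall x \ae mu, P x) -> \forall x \ae mu, P (alpha g x).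
Proof.
move=> [N [mN N0 PN]]; exists (alpha g @^-1` N); split.
- by rewrite -[_ @^-1` _]setTI; exact: (gact_measurable alpha g).
- by rewrite gact_preserving.
- by move=> x /= Px; exact: PN.
Qed.

Lemma ess_bounded_gact g (f : ess_bounded mu) :
  ess_bounded_pred mu (val f \o alpha g).
Proof.
have /asboolP[mf [K fK]] := valP f; apply/asboolP; split=> [A|].
  rewrite comp_preimage -[_ @^-1` _]setTI.
  by apply: (gact_measurable alpha g) => //; exact: mf.
by exists K; apply: (ae_gact (P := fun x => (`|val f x| <= K)%N)).
Qed.

Definition ess_bounded_act (f : ess_bounded mu) (g : Gam) : ess_bounded mu :=
  exist _ (val f \o alpha g) (ess_bounded_gact g f).

(** The right action [(f . g)(x) = f (g x)]. *)
Definition Linf_act (f : Linf mu) (g : Gam) : Linf mu :=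
  \pi_(Linf mu) (ess_bounded_act (repr f) g).

Lemma Linf_act_pi (f : ess_bounded mu) g :
  Linf_act (\pi_(Linf mu) f) g = \pi_(Linf mu) (ess_bounded_act f g).
Proof.
apply/eqP; rewrite -[_ == _]Quotient.idealrBE.
have : repr (\pi_(Linf mu) f) - f
    \in GRing.ZmodClosed.clone (ess_bounded mu) (@ae_zero _ _ _ mu) _.
  by rewrite Quotient.idealrBE reprK.
move=> /asboolP h; apply/asboolP.
by apply: filterS (ae_gact g h) => x; rewrite !raddfB.
Qed.

End Action.
End GammaSpaces.

(** The measurable space is Borel isomorphic to a Polish space; a Hausdorff
    second countable complete pseudometric space is Polish. *)
Definition standard_borel (R : realType) (d : measure_display)
    (X : measurableType d) :=
  exists (T : completePseudoMetricType R) (f : X -> T),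
    [/\ hausdorff_space T, @second_countable T, set_bij setT setT f
      & forall A : set X, measurable A <-> <<s @open T >> (f @` A)].

Section Bernoulli.
Context (R : realType) (Gam : groupType) (d : measure_display).
Context (B : measurableType d) (beta : probability B R).

Definition coordinate_sets : set (set (Gam -> B)) :=
  [set C | exists g A, measurable A /\ C = [set w | A (w g)]].

(** [B^Gam] with the product sigma-algebra *)
Definition bernoulli_space := g_sigma_algebraType coordinate_sets.

Definition product_measure
    (P : probability bernoulli_space R) :=
  forall (s : seq Gam) (A : Gam -> set B),
    uniq s -> (forall g, measurable (A g)) ->
    P [set w | forall g, g \in s -> A g (w g)] = (\prod_(g <- s) beta (A g))%E.

Definition shift (g : Gam) (w : bernoulli_space) : bernoulli_space :=
  fun h => w (g^-1 * h)%g.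

Lemma shift1 w : shift 1%g w = w.
Proof. by apply/funext => h; rewrite /shift invg1 mul1g. Qed.

Lemma shiftM g h w : shift (g * h)%g w = shift g (shift h w).
Proof. by apply/funext => k; rewrite /shift invgM mulgA. Qed.

Lemma measurable_shift g : measurable_fun setT (shift g).
Proof.
apply: (@measurability _ _ _ _ setT (shift g) coordinate_sets erefl) => _ [_ [k [A [mA ->]]] <-]; rewrite setTI.
by apply: sub_sigma_algebra; exists (g^-1 * k)%g, A.
Qed.

HB.instance Definition _ g := isMeasurableFun.Build _ _ bernoulli_space
  bernoulli_space (shift g) (measurable_shift g).

Variable P : probability bernoulli_space R.
Hypothesis HP : product_measure P.

Let cyl : set (set bernoulli_space) :=
  [set C | exists (s : seq Gam) (A : Gam -> set B),
    [/\ uniq s, forall g, measurable (A g)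
      & C = [set w | forall g, g \in s -> A g (w g)]]].

Let cylI : setI_closed cyl.
Proof.
move=> _ _ [s [A [us mA ->]]] [t [A' [ut mA' ->]]].
exists (undup (s ++ t)), (fun g => (if g \in s then A g else setT) `&`
  (if g \in t then A' g else setT)); split.
- exact: undup_uniq.
- by move=> g; apply: measurableI; case: ifP.
- apply/seteqP; split=> [w [/= ws wt] g _|w /= wst].
    by split; case: ifP => // ?; [exact: ws|exact: wt].
  split=> g gs; have := wst g; rewrite mem_undup mem_cat gs ?orbT /=.
    by move=> /(_ isT) [].
  by move=> /(_ isT) [].
Qed.

Let cylE : measurable = <<s cyl >> :> set (set bernoulli_space).
Proof.
apply/seteqP; split.
  apply: smallest_sub; first exact: smallest_sigma_algebra.
  move=> _ [k [A [mA ->]]]; apply: sub_sigma_algebra.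
  exists [:: k], (fun=> A); split=> //.
  by apply/seteqP; split=> w /= h; [move=> g; rewrite inE => /eqP ->
    |apply: h; rewrite inE].
apply: smallest_sub; first exact: sigma_algebra_measurable.
move=> _ [s [A [us mA ->]]].
rewrite (_ : [set _ | _] =
    \big[setI/setT]_(g <- s) [set w : bernoulli_space | A g (w g)]).
  apply: bigsetI_measurable => g _.
  by apply: sub_sigma_algebra; exists g, (A g).
by rewrite -bigcap_seq.
Qed.

Lemma shift_preserving g A : measurable A -> P (shift g @^-1` A) = P A.
Proof.
move=> mA; pose Q := distribution P
  [the {mfun bernoulli_space >-> bernoulli_space} of shift g].
rewrite -[LHS]/(Q A).
have cylT : \bigcup_(k : nat) [set: bernoulli_space] = setT by exact: bigcup_const.
have cT : forall k : nat, cyl setT.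
  by move=> _; exists [::], (fun=> setT); split=> //; apply/seteqP; split.
have := @measure_unique _ R bernoulli_space cyl (fun=> setT) cylE cylI cT cylT Q P.
move=> h; apply: h => //.
- move=> _ [s [A' [us mA' ->]]].
  transitivity (\prod_(k <- s) beta (A' k))%E; last first.
    by symmetry; exact: (HP us mA').
  pose s' := [seq (g^-1 * k)%g | k <- s].
  have us' : uniq s' by rewrite map_inj_uniq //; exact: mulgI.
  transitivity (P [set w : bernoulli_space |
      forall h, h \in s' -> A' (g * h)%g (w h)]).
    congr (P _); apply/seteqP; split=> w /= h.
      by move=> _ /mapP[k ks ->]; rewrite mulVKg; exact: h.
    by move=> k ks; rewrite -[k in A' k](mulVKg g); apply: h; exact: map_f.
  rewrite (HP (A := fun h => A' (g * h)%g)) // big_map.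
  by apply: eq_bigr => k _; rewrite mulVKg.
- move=> _; rewrite [X in (X < _)%E](_ : _ = 1%E) ?ltry //.
  exact: (@probability_setT _ _ _ P).
Qed.

Definition bernoulli_shift : gamma_space Gam P :=
  GammaSpace shift1 shiftM measurable_shift shift_preserving.

End Bernoulli.

Section ParametrizedNorm.
Variables (R : realType) (n : nat) (M Mt : topologicalType) (o : orientation R n M).
Variables (p : continuousType Mt M) (Gam : groupType).
Variable deck : Gam -> continuousType Mt Mt.
Context (d : measure_display) (X : measurableType d) (mu : probability X R).
Variable alpha : gamma_space Gam mu.

(** [C_k(M; alpha) = L^oo(X, mu, ZZ) (x)_{ZZ Gam} C_k(Mt; ZZ)] *)
Definition param_chain (k : nat) :=
  tensor (Linf_act alpha) (fun g => @chain_map R k Mt Mt (deck g)).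

Definition param_tens (k : nat) (f : Linf mu) (c : chain R k Mt) : param_chain k :=
  tens (Linf_act alpha) (fun g => @chain_map R k Mt Mt (deck g)) f c.

Definition param_boundary (k : nat) : param_chain k -> param_chain k.-1 :=
  tensor_map (fun g => @chain_map R k.-1 Mt Mt (deck g)) (@boundary R k Mt).

Lemma param_boundary_tens k f (c : chain R k Mt) :
  param_boundary (param_tens f c) = param_tens f (boundary c).
Proof.
apply: tensor_mapE => [x y|g x]; first exact: raddfD.
exact: chain_map_boundary.
Qed.

Lemma param_boundaryB k : {morph @param_boundary k : x y / x - y}.
Proof.
apply: tensor_mapB => [x y|g x]; first exact: raddfD.
exact: chain_map_boundary.
Qed.

(** The isomorphism of [ZZ (x)_{ZZ Gam} C_*(Mt; ZZ)] with [C_*(M; ZZ)] is induced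
    by [p]; so the image in [C_n(M; alpha)] of the chain [p_* z] of [M] is
    [1 (x) z]. *)
Definition param_fundamental_cycle (c : param_chain n) :=
  param_boundary c = 0 /\
  exists (z : chain R n Mt) (b : param_chain n.+1),
    fundamental_cycle o (chain_map p z) /\
    c - param_tens (Linf_one mu) z = param_boundary b.

(** Formal sums [\sum_j f_j (x) s_j] in reduced form. *)
Definition reduced_form (s : seq (Linf mu * simplex R n Mt)) :=
  uniq [seq push p fs.2 | fs <- s].

Definition param_simplicial_volume : \bar R :=
  ereal_inf [set v | exists s : seq (Linf mu * simplex R n Mt),
    [/\ reduced_form s,
        param_fundamental_cycle (\sum_(fs <- s) param_tens fs.1 << fs.2 >>)
      & v = (\sum_(fs <- s) integral_abs fs.1)%E]].

End ParametrizedNorm.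

(* Main.v *)
(** Let [c = 1 (x) z + d (\sum_l g_l (x) c_l)] be a fundamental cycle over the
    Bernoulli shift. In [L^1], each [g_l] is close to a bounded function [g'_l] of
    finitely many coordinates, so that the chain [1 (x) z + d (\sum_l g'_l (x) c_l)],
    whose coefficients are again such functions, has almost the same norm. As [alpha] is
    free and [X] is standard, a fine finite partition of [X] separates, off a small set,
    finitely many given translates of a point. Colouring its cells independently at
    random with law [beta] gives an equivariant map [Phi : X -> B^Gam], along which
    functions of finitely many coordinates have on average almost the same [L^1] norm as
    over [B^Gam]. Hence some colouring does not increase the norm of the chain by more
    than [epsilon], and [1 (x) z + d (\sum_l (g'_l \o Phi) (x) c_l)] is the required
    cycle over [alpha]. Norms are computed on the coefficients, which are well defined
    because [Gam] acts freely on singular simplices of the universal covering, with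
    quotient the singular simplices of [M]. *)

Require Import Defs.
From HB Require Import structures.
From mathcomp.multinomials Require Import freeg.
From mathcomp Require Import all_boot all_order all_algebra.
From mathcomp Require Import generic_quotient ring_quotient.
From mathcomp Require Import all_classical all_reals all_analysis.
From mathcomp Require Import wedge_sigT continuous_path.
From mathcomp Require Import measurable_realfun.
From mathcomp Require Import lra zify.

Set Implicit Arguments.
Unset Strict Implicit.
Unset Printing Implicit Defensive.

Import Order.TTheory GRing.Theory Num.Theory numFieldNormedType.Exports.

Local Open Scope classical_set_scope.
Local Open Scope ring_scope.
Local Open Scope quotient_scope.

(** * Lifts to the universal covering *)

Section Lifts.
Variables (R : realType) (Mt M : topologicalType) (p : Mt -> M).
Hypothesis pcov : covering_map p.

(** Near [t] each of [f], [f'] stays in one sheet over an evenly covered set. Agreement at [u] or at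
    [t] forces the two sheets to coincide, and [p] is injective on a sheet. The equivalence makes
    the agreement set open and closed at once. *)
Lemma lift_agree_open (T : topologicalType) (f f' : T -> Mt) :
  continuous f -> continuous f' -> (forall t, p (f t) = p (f' t)) ->
  forall t, \forall u \near t, (f u = f' u <-> f t = f' t).
Proof.
have [_ _ pV] := pcov; move=> fc fc' pff t.
have [U [I [V [[oU Ut] tV pUV Vs]]]] := pV (p (f t)).
have : (p @^-1` U) (f t) by [].
have : (p @^-1` U) (f' t) by rewrite /preimage /= -pff.
rewrite pUV => -[j _ Vj] [i _ Vi].
have [oVi [s [_ _ _ sp]]] := Vs i; have [oVj _] := Vs j.
have Ni : \forall u \near t, V i (f u).
  exact: fc t _ (open_nbhs_nbhs (conj oVi Vi)).
have Nj : \forall u \near t, V j (f' u).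
  exact: fc' t _ (open_nbhs_nbhs (conj oVj Vj)).
apply: filterS2 Ni Nj => u fu f'u.
split=> E.
- have ij : i = j by apply: tV => //; exists (f u); split => //; rewrite E.
  move: Vj; rewrite -ij => Vj.
  by rewrite -(sp (f t)) ?inE// pff sp ?inE.
- have ij : i = j by apply: tV => //; exists (f t); split => //; rewrite E.
  move: f'u; rewrite -ij => f'u.
  by rewrite -(sp (f u)) ?inE// pff sp ?inE.
Qed.

Lemma lift_unique (T : topologicalType) (f f' : T -> Mt) (t0 : T) :
  connected [set: T] -> continuous f -> continuous f' ->
  (forall t, p (f t) = p (f' t)) -> f t0 = f' t0 -> f =1 f'.
Proof.
move=> Tc fc fc' pff ff0 t.
have near_agree := lift_agree_open fc fc' pff.
suff E : [set t | f t = f' t] = setT by move: (I : setT t); rewrite -E.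
apply: Tc; first by exists t0.
- exists [set t | f t = f' t]; last by rewrite setTI.
  rewrite openE => u fu; apply: filterS (near_agree u) => v /=.
  by move=> ->.
- exists [set t | f t = f' t]; last by rewrite setTI.
  move=> u /(_ _ (near_agree u)) [v [/= fv]] [] + _.
  exact.
Qed.

Lemma glue_continuous (T : topologicalType) (f g : R -> T) (a : R) :
  continuous f -> continuous g -> f a = g a ->
  continuous (fun u => if u <= a then f u else g u).
Proof.
move=> fc gc fga u; have [ua|au|->] := ltgtP u a.
- rewrite /continuous_at (ltW ua) => W Wf.
  have fW : \forall v \near u, W (f v) by exact: fc u _ Wf.
  apply: filterS2 fW (lt_nbhsl ua) => v fv va.
  by rewrite /= (ltW va).
- rewrite /continuous_at leNgt au => W Wg.
  have gW : \forall v \near u, W (g v) by exact: gc u _ Wg.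
  apply: filterS2 gW (lt_nbhsr au) => v gv va.
  by rewrite /= leNgt va.
- rewrite /continuous_at lexx => W Wf.
  have fW : \forall v \near a, W (f v) by exact: fc a _ Wf.
  rewrite fga in Wf; have gW : \forall v \near a, W (g v) by exact: gc a _ Wf.
  by apply: filterS2 fW gW => v fv gv /=; case: ifP.
Qed.

Lemma clip_continuous (a b : R) : continuous (fun u : R => Num.max a (Num.min b u)).
Proof.
have c1 : continuous ((cst b : R -> R^o) \min id).
  by move=> s; apply: continuous_min; [exact: cst_continuous|].
have c0 : continuous ((cst a : R -> R^o) \max ((cst b : R -> R^o) \min id)).
  by move=> s; apply: continuous_max; [exact: cst_continuous|exact: c1].
exact: c0.
Qed.

Lemma comp_continuous (T U W : topologicalType) (f : T -> U) (g : U -> W) :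
  continuous f -> continuous g -> continuous (g \o f).
Proof. by move=> fc gc t; apply: continuous_comp; [exact: fc|exact: gc]. Qed.

(** The lift is continuous on all of [R] and constrained only on [[0, t]], which avoids subspace
    topologies. *)
Definition lifts_until (l : R -> M) (y : Mt) (t : R) :=
  exists m : R -> Mt, [/\ continuous m, m 0 = y & forall u, 0 <= u <= t -> p (m u) = l u].

(** A lift that ends inside an evenly covered neighbourhood of [l s] is continued by the section of
    its sheet. The step [e] depends on [s] but not on [t], as the supremum argument requires. *)
Lemma lifts_until_extend (l : R -> M) (y : Mt) (s : R) :
  continuous l -> exists2 e : R, 0 < e &
  forall t, 0 <= t -> s - e < t <= s -> lifts_until l y t -> lifts_until l y (s + e).
Proof.
have [_ _ pV] := pcov; move=> lc.
have [U [I [V [[oU Ut] tV pUV Vs]]]] := pV (l s).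
have /nbhs_ballP[d /= d0 dU] := lc s _ (open_nbhs_nbhs (conj oU Ut)).
exists (d / 2); first by rewrite divr_gt0.
move=> t t0 /andP[st ts] [m [mc m0 ml]].
have d2 : d / 2 < d by rewrite ltr_pdivrMr// ltr_pMr// ltr1n.
have lU u : t <= u <= s + d / 2 -> U (l u).
  move=> /andP[tu us]; apply: dU; rewrite /ball /= ltr_norml.
  by apply/andP; split; lra.
have Umt : (p @^-1` U) (m t).
  by rewrite /preimage /= ml ?lexx ?t0//; apply: lU; lra.
rewrite pUV in Umt; case: Umt => i _ Vimt.
have [oVi [sg [sgc sgV ps sp]]] := Vs i.
(* Clipping the argument to [[t, s + d / 2]] keeps [l] inside [U], where [sg] is continuous; so [g]
   is continuous on all of [R]. *)
pose g u := sg (l (Num.max t (Num.min (s + d / 2) u))).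
have Ug u : U (l (Num.max t (Num.min (s + d / 2) u))).
  by apply: lU; rewrite le_max lexx /= ge_max ge_min lexx /= andbT; lra.
have gc : continuous g.
  move=> u; have lcc := comp_continuous (@clip_continuous t (s + d / 2)) lc.
  apply: (@continuous_comp _ _ _ _ sg); first exact: lcc.
  have := sgc; rewrite continuous_open_subspace// => /(_ _ (mem_set (Ug u))).
  exact.
exists (fun u => if u <= t then m u else g u); split.
- apply: glue_continuous => //.
  rewrite /g (_ : Num.max _ _ = t); last first.
    by apply/max_idPl; rewrite ge_min lexx orbT.
  by rewrite -ml ?t0 ?lexx// sp// inE.
- by rewrite t0.
- move=> u /andP[u0 us]; case: ifPn => [ut|]; first by apply: ml; rewrite u0.
  rewrite -ltNge => tu; rewrite /g ps ?inE//.
  by rewrite (min_idPr us) (max_idPr (ltW tu)).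
Qed.

(** If no lift reached 1, [lifts_until_extend] at the supremum of the times reached in [[0, 1]]
    would give a time beyond that supremum. *)
Lemma lifts_until1 (l : R -> M) (y : Mt) :
  continuous l -> p y = l 0 -> lifts_until l y 1.
Proof.
move=> lc py.
have lifts_le t u : t <= u -> lifts_until l y u -> lifts_until l y t.
  move=> tu [m [mc m0 ml]]; exists m; split=> // v /andP[v0 vt].
  by apply: ml; rewrite v0 (le_trans vt).
pose E : set R := [set t | 0 <= t <= 1 /\ lifts_until l y t].
have E0 : E 0.
  split; first by rewrite lexx ler01.
  exists (cst y); split=> [|//|u]; first exact: cst_continuous.
  by rewrite -eq_le => /eqP <-.
have supE : has_sup E.
  by split; [exists 0|exists 1 => t [/andP[]]].
have [e e0 ext] := lifts_until_extend y (sup E) lc.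
have [t [/andP[t0 t1] lt] st] := sup_adherent e0 supE.
have ts : t <= sup E.
  by apply: ub_le_sup; [exact: supE.2|split; rewrite ?t0].
have lse : lifts_until l y (sup E + e) by apply: (ext t) => //; rewrite st.
have [se1|se1] := leP 1 (sup E + e); first exact: lifts_le lse.
suff : sup E + e <= sup E by move: e0; lra.
apply: ub_le_sup; first exact: supE.2.
by split=> //; apply/andP; split; [move: t0 ts e0; lra|exact: ltW].
Qed.

Lemma clamp_itvK (t : unit_itv R) : clamp (val t) = t.
Proof.
apply: val_inj => /=; have := set_mem (valP t).
rewrite /= in_itv /= => /andP[t0 t1].
by rewrite /clamp_val (min_idPr t1) (max_idPr t0).
Qed.

Lemma path_lift (l : unit_itv R -> M) (y : Mt) :
  continuous l -> p y = l zero ->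
  exists m : continuousType (unit_itv R) Mt,
    m zero = y /\ forall t, p (m t) = l t.
Proof.
move=> lc py.
have [||m [mc m0 ml]] := @lifts_until1 (l \o @clamp R) y.
- exact: comp_continuous (@clamp_continuous R) lc.
- exact: py.
have vc : continuous (m \o (val : unit_itv R -> R)).
  by apply: comp_continuous mc; exact: initial_continuous.
exists (HB.pack_for (continuousType (unit_itv R) Mt)
  (m \o (val : unit_itv R -> R)) (isContinuous.Build _ _ (m \o (val : unit_itv R -> R)) vc)); split=> [|t] /=.
  by rewrite /= /clamp_val (min_idPr ler01) maxxx.
have := set_mem (valP t); rewrite /= in_itv /= => t01.
by rewrite ml//= clamp_itvK.
Qed.

Lemma R_connected : connected [set: R].
Proof. by apply/connected_intervalP => x y _ _ z. Qed.

Lemma path_lift_unique (m m' : unit_itv R -> Mt) t0 :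
  continuous m -> continuous m' -> (forall t, p (m t) = p (m' t)) ->
  m t0 = m' t0 -> m =1 m'.
Proof.
move=> mc mc' pmm mm0 t; rewrite -(clamp_itvK t).
apply: (@lift_unique R (m \o @clamp R) (m' \o @clamp R) (val t0)).
- exact: R_connected.
- exact: comp_continuous (@clamp_continuous R) mc.
- exact: comp_continuous (@clamp_continuous R) mc'.
- by move=> u; exact: pmm.
- by rewrite /= clamp_itvK.
Qed.

End Lifts.

(** * Freeness and transitivity of deck transformations, on points and on singular simplices *)

Section Deck.
Variables (R : realType) (Mt M : topologicalType) (p : continuousType Mt M).
Hypothesis puniv : universal_covering R p.
Variables (y0 : Mt) (Gam : groupType).
Variable cls : {path (unit_itv R) from (p y0) to (p y0)} -> Gam.
Hypothesis clsP : is_fundamental_group cls.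
Variable deck : Gam -> continuousType Mt Mt.
Hypothesis deckP : deck_action cls deck.

Let pcov : covering_map p. Proof. exact: puniv.1. Qed.

Lemma path_between (y y' : Mt) :
  exists m : continuousType (unit_itv R) Mt, m zero = y /\ m one = y'.
Proof.
have [m] := puniv.2.1 y y'; exists m.
by split; [exact: (@path_zero _ _ _ _ m)|exact: (@path_one _ _ _ _ m)].
Qed.

Lemma deck_agree (f f' : continuousType Mt Mt) y :
  (forall u, p (f u) = p (f' u)) -> f y = f' y -> f =1 f'.
Proof.
move=> pff fy u; have [m [m0 <-]] := path_between y u.
apply: (path_lift_unique pcov (m := f \o m) (m' := f' \o m) (t0 := zero)).
- exact: comp_continuous (@cts_fun _ _ m) (@cts_fun _ _ f).
- exact: comp_continuous (@cts_fun _ _ m) (@cts_fun _ _ f').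
- by move=> t; exact: pff.
- by rewrite /= m0.
Qed.

Lemma path_of (X : topologicalType) (f : unit_itv R -> X) x x' :
  continuous f -> f zero = x -> f one = x' ->
  exists l : {path unit_itv R from x to x'}, l =1 f.
Proof.
move=> fc f0 f1.
by exists (mk_path fc f0 f1).
Qed.

(** The constant loop concatenated with itself is equal to itself, so its class is idempotent. *)
Lemma cls_cst_loop : cls (cst_loop R (p y0)) = 1%g.
Proof.
have [_ _ clsM] := clsP.
have := clsM (cst_loop R (p y0)) (cst_loop R (p y0)).
rewrite (_ : concat _ _ = cst_loop R (p y0)).
  by move/(congr1 (fun g => (cls (cst_loop R (p y0)))^-1 * g)%g); rewrite mulKg mulVg.
by apply/path_eqP => t; rewrite /= /concat_fun; case: ifP.
Qed.

(** If [g] fixes a point, it acts as the identity, so a loop of class [g] lifts to a loop at [y0].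
    This loop is contractible in [Mt], and [p] maps the contraction to one of the original loop. *)
Lemma deck_free y g : deck g y = y -> g = 1%g.
Proof.
have [deck1 _ deckp deckl] := deckP; have [clss clsh _] := clsP.
move=> gy; have gid : deck g =1 deck 1%g.
  by apply: (@deck_agree _ _ y) => [u|]; rewrite ?deckp// gy deck1.
have [l lg] := clss g.
have [||m [m0 ml]] := path_lift pcov (l := l) (y := y0).
- by move=> t; exact: cts_fun.
- by rewrite path_zero.
have := deckl l m ml m0; rewrite lg gid deck1 => m1.
have [q qm] := path_of (@cts_fun _ _ m) m0 m1.
have [H [Hc [H0 H1 Hz Ho]]] := puniv.2.2 y0 q.
rewrite -lg -cls_cst_loop; apply/clsh; exists (p \o H); split.
  exact: comp_continuous Hc (@cts_fun _ _ p).
split=> [t|t|s|s] /=; rewrite ?H0 ?H1 ?Hz ?Ho//.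
by rewrite qm ml.
Qed.

(** Let [q] run from [y] to [y0], and let [q'] be the lift of [p \o q] from [y']. A path from [y0]
    to the end of [q'] projects to a loop whose class moves [y0] to that end. The translate of [q]
    by this class and [q'] lift the same path and agree at [one], hence also at [zero]. *)
Lemma deck_transitive y y' : p y = p y' -> exists g, deck g y = y'.
Proof.
have [deck1 deckM deckp deckl] := deckP.
move=> pyy.
have [q [q0 q1]] := path_between y y0.
have [||q' [q'0 q'l]] := path_lift pcov (l := p \o q) (y := y').
- exact: comp_continuous (@cts_fun _ _ q) (@cts_fun _ _ p).
- by rewrite /= q0.
have [m [m0 m1]] := path_between y0 (q' one).
have [l lm] : exists l : {path unit_itv R from (p y0) to (p y0)}, l =1 p \o m.
  apply: (@path_of M (p \o m)) => /=; [|by rewrite m0|].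
    exact: comp_continuous (@cts_fun _ _ m) (@cts_fun _ _ p).
  by rewrite m1 q'l /= q1.
have gy0 : m one = deck (cls l) y0 by apply: deckl => // t; rewrite lm.
exists (cls l).
have E : deck (cls l) \o q =1 q'.
  apply: (path_lift_unique pcov (t0 := one)) => [||t|].
  - exact: comp_continuous (@cts_fun _ _ q) (@cts_fun _ _ (deck (cls l))).
  - by move=> t; exact: cts_fun.
  - by rewrite q'l /= deckp.
  - by rewrite /= q1 -gy0 m1.
by rewrite -q0 -q'0; exact: E.
Qed.

Let stdsimplex_segment k (a b : 'rV[R]_k.+1) (u : R) : stdsimplex a -> stdsimplex b ->
  stdsimplex ((1 - clamp_val u) *: a + clamp_val u *: b).
Proof.
have /set_mem := clamp_subproof u; rewrite /= in_itv /= => /andP[u0 u1].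
move=> [a0 a1] [b0 b1]; split=> [i|].
  by rewrite !mxE addr_ge0// mulr_ge0// subr_ge0.
under eq_bigr do rewrite !mxE.
by rewrite big_split /= -!mulr_sumr a1 b1 !mulr1 subrK.
Qed.

(** The segment is extended constantly to all of [R], so that uniqueness of lifts applies with the
    connected space [R]. *)
Lemma Delta_segment k (a b : Delta R k) :
  exists f : R -> Delta R k, [/\ continuous f, f 0 = a & f 1 = b].
Proof.
exists (fun u => exist (fun x => x \in @stdsimplex R k) _ (mem_set (stdsimplex_segment u
  (set_mem (valP a)) (set_mem (valP b))))); split.
- apply: continuous_comp_initial.
  have cc : continuous (@clamp_val R) := @clip_continuous R 0 1.
  move=> u; apply: (@cvgD _ _ _ _ _ (fun u => (1 - clamp_val u) *: val a)
    (fun u => clamp_val u *: val b)).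
  + by apply: cvgZr_tmp; apply: cvgB; [exact: cvg_cst|exact: cc].
  + by apply: cvgZr_tmp; exact: cc.
- apply: val_inj => /=; rewrite /clamp_val (min_idPr ler01) maxxx.
  by rewrite subr0 scale1r scale0r addr0.
- apply: val_inj => /=; rewrite /clamp_val minxx (max_idPr ler01).
  by rewrite subrr scale1r scale0r add0r.
Qed.

Lemma simplex_agree k (s s' : simplex R k Mt) a :
  (forall u, p (s u) = p (s' u)) -> s a = s' a -> s = s'.
Proof.
move=> pss sa; apply/continuousEP => b.
have [f [fc f0 f1]] := Delta_segment a b.
have : s \o f =1 s' \o f.
  apply: (lift_unique pcov (t0 := 0)) => [|||u|].
  - exact: R_connected.
  - exact: comp_continuous fc (@cts_fun _ _ s).
  - exact: comp_continuous fc (@cts_fun _ _ s').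
  - exact: pss.
  - by rewrite /= f0.
by move/(_ 1); rewrite /= f1.
Qed.

Lemma Delta_inhabited k : exists a : Delta R k, True.
Proof.
suff st : stdsimplex (\row_j (j == 0)%:R : 'rV[R]_k.+1).
  by exists (exist (fun x => x \in @stdsimplex R k) _ (mem_set st)).
split=> [i|]; first by rewrite mxE.
rewrite (bigD1 0) //= mxE eqxx big1 ?addr0// => i /negbTE i0.
by rewrite mxE i0.
Qed.

Lemma push_deck_free k (s : simplex R k Mt) g : push (deck g) s = s -> g = 1%g.
Proof.
have [a _] := Delta_inhabited k.
by move/continuousEP => /(_ a); exact: deck_free.
Qed.

Lemma push_deck_transitive k (s s' : simplex R k Mt) :
  push p s = push p s' -> exists g, push (deck g) s = s'.
Proof.
have [_ _ deckp _] := deckP.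
move=> /continuousEP pss.
have [a _] := Delta_inhabited k.
have [g gs] := deck_transitive (pss a).
exists g; apply: (simplex_agree (a := a)) => [u|]; last exact: gs.
by rewrite /= deckp; exact: pss.
Qed.

End Deck.

(** * Tensor products over free orbits *)

Section AdditiveMaps.
Variables (U V : zmodType) (f : U -> V).
Hypothesis fB : {morph f : x y / x - y}.

Let F : {additive U -> V} :=
  HB.pack_for {additive U -> V} f (GRing.isZmodMorphism.Build _ _ f fB).

Lemma morphB0 : f 0 = 0. Proof. exact: (raddf0 F). Qed.
Lemma morphBD x y : f (x + y) = f x + f y. Proof. exact: (raddfD F). Qed.
Lemma morphBz x n : f (x *~ n) = f x *~ n. Proof. exact: (raddfMz F). Qed.
Lemma morphB_sum (I : Type) (r : seq I) (P : pred I) (E : I -> U) :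
  f (\sum_(i <- r | P i) E i) = \sum_(i <- r | P i) f (E i).
Proof. exact: (raddf_sum F). Qed.

End AdditiveMaps.

Lemma freegE (K : choiceType) (c : {freeg K}) :
  c = \sum_(k <- dom c) << k >> *~ coeff k c.
Proof.
rewrite -[LHS]freeg_sumE; apply: eq_bigr => k _.
by rewrite freeg_mulz intz.
Qed.

Lemma morphB_freegE (K : choiceType) (V : zmodType) (f : {freeg K} -> V) c :
  {morph f : x y / x - y} -> f c = \sum_(k <- dom c) f << k >> *~ coeff k c.
Proof.
move=> fB; rewrite [in LHS](freegE c) morphB_sum//.
by apply: eq_bigr => k _; rewrite morphBz.
Qed.

Lemma morphB_freeg_ext (K : choiceType) (V : zmodType) (f g : {freeg K} -> V) :
  {morph f : x y / x - y} -> {morph g : x y / x - y} ->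
  (forall k, f << k >> = g << k >>) -> f =1 g.
Proof.
move=> fB gB fg c; rewrite (morphB_freegE _ fB) (morphB_freegE _ gB).
by apply: eq_bigr => k _; rewrite fg.
Qed.

(** * The boundary of a boundary vanishes *)

Section Boundary.
Variable R : realType.

Lemma bump_comm_inj (i i' j j' a b c d : nat) :
  i' = bump i j -> i = bump i' j' -> bump i a = bump i' b -> a = bump j c ->
  b = bump j' d -> c = d.
Proof. rewrite /bump. lia. Qed.

(** The pairs [(i, j)] and [(i', j')] describe the same two vertices in both orders: either
    composite inserts zeros exactly at [i] and [i']. This form of the simplicial identity needs no
    case [i < i']. *)
Lemma face_row_comm k (i i' : 'I_k.+3) (j j' : 'I_k.+2) (t : 'rV[R]_k.+1) :
  i' = lift i j -> i = lift i' j' ->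
  face_row i (face_row j t) = face_row i' (face_row j' t).
Proof.
move=> ij' ji'; apply/rowP => m; rewrite !mxE.
case: unliftP => [m1 m1E|mi]; last first.
  rewrite mi; case: unliftP => [m2 m2E|//]; rewrite mxE.
  by rewrite ji' in m2E; rewrite -(lift_inj m2E) unlift_none.
case: unliftP => [m2 m2E|mi']; last first.
  by rewrite mxE; rewrite mi' ij' in m1E; rewrite -(lift_inj m1E) unlift_none.
rewrite !mxE.
case: unliftP => [m3 m3E|m1j]; case: unliftP => [m4 m4E|m2j'] //.
- congr (t 0 _); apply: val_inj.
  apply: (@bump_comm_inj i i' j j' m1 m2).
  + by rewrite ij'.
  + by rewrite ji'.
  + by have := congr1 val m1E; rewrite m2E.
  + by rewrite m3E.
  + by rewrite m4E.
- by have := neq_lift i m1; rewrite -m1E m2E m2j' -ji' eqxx.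
- by have := neq_lift i' m2; rewrite -m2E m1E m1j -ij' eqxx.
Qed.

Lemma dface_comm k (X : topologicalType) (s : simplex R k.+2 X)
    (i i' : 'I_k.+3) (j j' : 'I_k.+2) :
  i' = lift i j -> i = lift i' j' -> dface j (dface i s) = dface j' (dface i' s).
Proof.
move=> ij ji; apply/continuousEP => t /=; congr (s _).
by apply: val_inj; exact: face_row_comm.
Qed.

Lemma boundary_boundary k (X : topologicalType) (c : chain R k X) :
  boundary (boundary c) = 0.
Proof.
case: k c => [|[|k]] c; [exact: raddf0|by []|].
pose F : {additive chain R k.+2 X -> chain R k X} :=
  @boundary R k.+1 X \o @boundary R k.+2 X.
pose G : {additive chain R k.+2 X -> chain R k X} := \0%R.
apply: (@freeg_additive_ext _ _ F G) => s.
rewrite /F /G /= -[boundary_succ << s >>]/(boundary << s >>) boundaryU.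
rewrite -[boundary_succ _]/(boundary _) raddf_sum.
pose V (i : 'I_k.+3) (j : 'I_k.+2) : chain R k X := << (-1) ^+ (i + j) *g dface j (dface i s) >>.
rewrite (eq_bigr (fun i => \sum_(j < k.+2) V i j)); last first.
  move=> i _; rewrite -[LHS]/(fglift _ _) liftU scaler_sumr.
  apply: eq_bigr => j _; apply/eqP/freeg_eqP => x.
  by rewrite coeffZ !coeffU exprD mulrA.
(* The terms are indexed by ordered pairs of distinct vertices, and exchanging the two
   vertices changes the sign. *)
pose W (i i' : 'I_k.+3) : chain R k X := if unlift i i' is Some j then V i j else 0.
have VW i : \sum_(j < k.+2) V i j = \sum_i' W i i'.
  rewrite (bigD1_ord i)//= {1}/W unlift_none add0r.
  by apply: eq_bigr => j _; rewrite /W liftK.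
rewrite (eq_bigr _ (fun i _ => VW i)) -[RHS]/(0 : chain R k X).
have WN i i' : W i i' = - W i' i.
  rewrite /W; case: (unliftP i i') => [j ij|->]; last by rewrite unlift_none oppr0.
  case: (unliftP i' i) => [j' ji|ii]; last first.
    by move: (neq_lift i j); rewrite -ij ii eqxx.
  rewrite /V freegUN; congr (<< _ *g _ >>).
    have [->|->] : (i + j = (i' + j').+1 \/ i' + j' = (i + j).+1)%N.
    - have : nat_of_ord i' = bump i j by rewrite ij.
      have : nat_of_ord i = bump i' j' by rewrite ji.
      rewrite /bump; lia.
    - by rewrite exprS mulN1r.
    - by rewrite exprS mulN1r opprK.
  exact: dface_comm.
pose S := \sum_i \sum_i' W i i'.
have SN : S = - S.
  rewrite {1}/S exchange_big /= -sumrN; apply: eq_bigr => i _.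
  by rewrite -sumrN; apply: eq_bigr => i' _.
(* The coefficients are integers, so a chain equal to its own negative is zero. *)
rewrite -[LHS]/S; apply/eqP/freeg_eqP => x.
have := congr1 (coeff x) SN; rewrite coeffN coeff0; lia.
Qed.
End Boundary.

Lemma uniq_map_inj_in (T T' : eqType) (f : T -> T') (s : seq T) :
  uniq (map f s) -> {in s &, injective f}.
Proof.
elim: s => [|a s IHs] //= /andP[fa us] x y; rewrite !inE.
move=> /predU1P[->|xs] /predU1P[->|ys] // fxy; last exact: IHs.
- by move: fa; rewrite fxy map_f.
- by move: fa; rewrite -fxy map_f.
Qed.

(** * Elementary tensors and the universal property *)

Section TensorElements.
Variables (Gam : Type) (A C : zmodType).
Variables (ract : A -> Gam -> A) (lact : Gam -> C -> C).

Local Notation T := (tensor ract lact).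
Local Notation tens := (tens ract lact).

Let pi_rel (x y z : {freeg (A * C)%type}) :
  tensor_relations ract lact (x - y - z) ->
  \pi_(Quotient.quot (gen_zmodClosed (tensor_relations ract lact))) x =
  \pi_(Quotient.quot (gen_zmodClosed (tensor_relations ract lact))) y +
  \pi_(Quotient.quot (gen_zmodClosed (tensor_relations ract lact))) z.
Proof.
move=> xyz; apply/eqP; rewrite addrC -subr_eq -quot_piB.
rewrite -[_ == _]Quotient.idealrBE.
by apply/asboolP => H _; apply.
Qed.

Lemma tensDl a a' c : tens (a + a') c = tens a c + tens a' c.
Proof. by apply: pi_rel; left; left; exists a, a', c. Qed.

Lemma tensDr a c c' : tens a (c + c') = tens a c + tens a c'.
Proof. by apply: pi_rel; left; right; exists a, c, c'. Qed.

Lemma tens_balanced a g c : tens (ract a g) c = tens a (lact g c).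
Proof.
apply/eqP; rewrite -[_ == _]Quotient.idealrBE; apply/asboolP => H _; apply.
by right; exists a, g, c.
Qed.

Lemma tensBl c : {morph tens^~ c : a a' / a - a'}.
Proof. by move=> a a' /=; apply/eqP; rewrite eq_sym subr_eq -tensDl subrK. Qed.

Lemma tensBr a : {morph tens a : c c' / c - c'}.
Proof. by move=> c c'; apply/eqP; rewrite eq_sym subr_eq -tensDr subrK. Qed.

Lemma tens0r a : tens a 0 = 0.
Proof. by rewrite (morphB0 (@tensBr a)). Qed.

Lemma tens0l c : tens 0 c = 0.
Proof. by rewrite (morphB0 (@tensBl c)). Qed.

(** A representative is an integral combination of pairs, and each integer is absorbed into the
    second factor. *)
Lemma tensor_sum_tens (t : T) :
  exists s : seq (A * C), t = \sum_(ac <- s) tens ac.1 ac.2.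
Proof.
exists [seq (ac.1, ac.2 *~ coeff ac (repr t)) | ac <- dom (repr t)].
rewrite big_map /= -[LHS](reprK t) [in LHS](freegE (repr t)).
have piB : {morph \pi_(Quotient.quot (gen_zmodClosed (tensor_relations ract lact))) :
  x y / x - y} by exact: quot_piB.
rewrite -[LHS]/(\pi_(Quotient.quot _) _) (morphB_sum piB).
apply: eq_bigr => -[a c] _; rewrite (morphBz piB).
by rewrite -(morphBz (@tensBr a)).
Qed.

Section Lift.
Variables (V : zmodType) (f : A -> C -> V).
Hypothesis fBl : forall c, {morph f^~ c : a a' / a - a'}.
Hypothesis fBr : forall a, {morph f a : c c' / c - c'}.
Hypothesis f_balanced : forall a g c, f (ract a g) c = f a (lact g c).

(** The linear extension of [f] to formal sums kills the generated subgroup, since its zero set is a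
    subgroup containing the relations. *)
Lemma tensor_lift :
  exists F : T -> V, {morph F : x y / x - y} /\ forall a c, F (tens a c) = f a c.
Proof.
(* The alias [zmodule V] carries the structure of a module over the integers that [fglift] expects
   of its target. *)
pose F0 : {freeg (A * C)%type} -> zmodule V :=
  fglift (fun ac : A * C => f ac.1 ac.2 : zmodule V).
have F0B : {morph F0 : x y / x - y} by exact: lift_is_additive.
have F01 a c : F0 << (a, c) >> = f a c by rewrite /F0 liftU scale1r.
have F0pi x : F0 (repr (\pi_T x)) = F0 x.
  apply/eqP; rewrite -subr_eq0 -F0B.
  have : repr (\pi_T x) - x \in gen_zmodClosed (tensor_relations ract lact).
    by rewrite Quotient.idealrBE reprK.
  move: (_ - x) => y /asboolP yS; apply/eqP.
  apply: (yS [set z | F0 z = 0]) => [|z].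
    split=> [|u v /= u0 v0]; first exact: morphB0.
    by rewrite F0B u0 v0 subrr.
  move=> [[]|] [a [b [c ->]]] /=; rewrite !F0B !F01.
  - by rewrite (morphBD (fBl c)) -addrA -opprD subrr.
  - by rewrite (morphBD (fBr a)) -addrA -opprD subrr.
  - by rewrite f_balanced subrr.
exists (F0 \o repr); split=> [x y|a c] /=; last by rewrite F0pi F01.
rewrite -[x]reprK -[y]reprK.
rewrite -[repr x]/(repr (x : Quotient.quot _)).
by rewrite -quot_piB F0pi F0B !F0pi.
Qed.

End Lift.
End TensorElements.

(** * Coefficients of tensors over a free permutation module *)

Section OrbitCoefficients.
Variables (Gam : groupType) (S S' : choiceType) (act : Gam -> S -> S) (h : S -> S').
Hypothesis act1 : forall s, act 1%g s = s.
Hypothesis actM : forall g g' s, act (g * g')%g s = act g (act g' s).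
Hypothesis act_free : forall s g, act g s = s -> g = 1%g.
Hypothesis h_act : forall g s, h (act g s) = h s.
Hypothesis h_fiber : forall s s', h s = h s' -> exists g, act g s = s'.

(** Freeness makes the chosen element unique; see [transporter_act]. *)
Definition transporter (r s : S) : option Gam :=
  if pselect (exists g, act g r = s) is left e then Some (projT1 (cid e)) else None.

Lemma act_inj g g' s : act g s = act g' s -> g = g'.
Proof.
move=> gs; have /act_free : act (g'^-1 * g)%g s = s.
  by rewrite actM gs -actM mulVg act1.
by move/(congr1 (fun x => g' * x)%g); rewrite mulVKg mulg1.
Qed.

Lemma transporter_act r g : transporter r (act g r) = Some g.
Proof.
rewrite /transporter; case: pselect => [e|[]]; last by exists g.
by congr Some; exact: act_inj (projT2 (cid e)).
Qed.

Lemma transporter_none r s : h r <> h s -> transporter r s = None.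
Proof.
rewrite /transporter; case: pselect => // -[g gr] [].
by rewrite -gr h_act.
Qed.

Definition lact g : {freeg S} -> {freeg S} := fglift (fun s => << act g s >>).

Lemma lactU g s : lact g << s >> = << act g s >>.
Proof. by rewrite /lact liftU scale1r. Qed.

Lemma lactB g : {morph lact g : c c' / c - c'}.
Proof. exact: lift_is_additive. Qed.

Section Module.
Variables (A : zmodType) (ract : A -> Gam -> A).
Hypothesis ractB : forall g, {morph ract^~ g : a a' / a - a'}.
Hypothesis ractM : forall a g g', ract a (g * g')%g = ract (ract a g) g'.

(** For [s = act g r], balancing turns [a (x) s] into [ract a g (x) r], which explains the value;
    other orbits contribute 0. *)
Definition simplex_coef (r : S) (a : A) (s : S) : A :=
  oapp (ract a) 0 (transporter r s).

(** The coefficient at [r] of [a (x) c], in the decomposition of the tensor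
    product [A (x) Z[S]] as a sum of copies of [A] indexed by the orbits. *)
Definition orbit_coef (r : S) (a : A) (c : {freeg S}) : A :=
  \sum_(s <- dom c) simplex_coef r a s *~ coeff s c.

Lemma simplex_coefB r s : {morph simplex_coef r ^~ s : a a' / a - a'}.
Proof.
move=> a a'; rewrite /simplex_coef; case: transporter => [g|] /=.
  exact: ractB.
by rewrite subrr.
Qed.

Lemma orbit_coefBl r c : {morph orbit_coef r ^~ c : a a' / a - a'}.
Proof.
move=> a a'; rewrite /orbit_coef -sumrB; apply: eq_bigr => s _.
by rewrite simplex_coefB mulrzBl.
Qed.

Let orbit_coefE r a c :
  orbit_coef r a c = fglift (fun s => simplex_coef r a s : zmodule A) c.
Proof.
rewrite (morphB_freegE (f := fglift _ : _ -> zmodule A)); last exact: lift_is_additive.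
by apply: eq_bigr => s _; rewrite liftU scale1r.
Qed.

Lemma orbit_coefBr r a : {morph orbit_coef r a : c c' / c - c'}.
Proof. by move=> c c'; rewrite !orbit_coefE lift_is_additive. Qed.

Lemma orbit_coefU r a s : orbit_coef r a << s >> = simplex_coef r a s.
Proof. by rewrite orbit_coefE liftU scale1r. Qed.

(** On a basis element [act g' r] both sides are the action of [g * g'] on [a]. *)
Lemma orbit_coef_balanced r a g c :
  orbit_coef r (ract a g) c = orbit_coef r a (lact g c).
Proof.
move: c; apply: morphB_freeg_ext; first exact: orbit_coefBr.
  by move=> c c'; rewrite lactB orbit_coefBr.
move=> s; rewrite lactU !orbit_coefU /simplex_coef.
have [rs|rs] := pselect (h r = h s); last first.
  by rewrite !transporter_none// h_act.
have [g' <-] := h_fiber rs.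
by rewrite -actM !transporter_act /= ractM.
Qed.

Local Notation tens := (tens ract lact).

(** This makes the coefficient at [r] an invariant of the tensor, so that equal sums of elementary
    tensors have equal coefficients. *)
Lemma tensor_orbit_coef r : exists F : tensor ract lact -> A,
  {morph F : x y / x - y} /\ forall a c, F (tens a c) = orbit_coef r a c.
Proof.
apply: tensor_lift.
- exact: orbit_coefBl.
- exact: orbit_coefBr.
- exact: orbit_coef_balanced.
Qed.

Lemma tens_orbit_coef (rs : seq S) a c :
  uniq (map h rs) -> (forall s, s \in dom c -> h s \in map h rs) ->
  tens a c = \sum_(r <- rs) tens (orbit_coef r a c) << r >>.
Proof.
move=> urs crs; rewrite [in LHS](freegE c) (morphB_sum (@tensBr _ _ _ ract lact a)).
under [RHS]eq_bigr => r _ do rewrite /orbit_coef (morphB_sum (@tensBl _ _ _ ract lact << r >>)).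
rewrite exchange_big /= big_seq [RHS]big_seq; apply: eq_bigr => s /crs /mapP[r rr sr].
rewrite (bigD1_seq r)//=; last exact: map_uniq urs.
rewrite big_seq_cond big1 ?addr0 => [|r' /andP[r'r r'nr]]; last first.
  rewrite /simplex_coef transporter_none ?mul0rz ?tens0l//.
  rewrite sr => rr'; move/eqP: r'nr; apply.
  exact: (uniq_map_inj_in urs).
have [g <-] := h_fiber (esym sr).
rewrite (morphBz (@tensBr _ _ _ ract lact a)) (morphBz (@tensBl _ _ _ ract lact << r >>)).
by rewrite /simplex_coef transporter_act /= tens_balanced lactU.
Qed.

(** For invariant [a] the group elements are forgotten, and only the image of [c] under [h] counts.
    Applied to the constant function 1, this relates [1 (x) z] to the chain [p_* z]. *)
Lemma orbit_coef_fixed r a c : (forall g, ract a g = a) ->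
  orbit_coef r a c = a *~ coeff (h r) (fglift (fun s => << h s >>) c : {freeg S'}).
Proof.
move=> aP; move: c; apply: morphB_freeg_ext.
- exact: orbit_coefBr.
- by move=> c c'; rewrite lift_is_additive coeffB mulrzBr.
move=> s; rewrite orbit_coefU liftU scale1r coeffU mul1r /simplex_coef.
have [rs|rs] := eqVneq (h s) (h r).
  by have [g <-] := h_fiber (esym rs); rewrite transporter_act /= aP.
by rewrite transporter_none//; apply/eqP; rewrite eq_sym.
Qed.

(** A coefficient is an integral combination of translates of [a]. The lemma serves for
    measurability and for dependence on finitely many coordinates. *)
Lemma orbit_coef_closed (N : A -> Prop) r a c :
  N 0 -> (forall a a', N a -> N a' -> N (a - a')) -> (forall a g, N a -> N (ract a g)) ->
  N a -> N (orbit_coef r a c).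
Proof.
move=> N0 NB Nr Na.
have NN x : N x -> N (- x) by move=> Nx; rewrite -sub0r; exact: NB.
have ND x y : N x -> N y -> N (x + y).
  by move=> Nx Ny; rewrite -[y]opprK; apply: NB => //; exact: NN.
apply: (big_ind N) => // s _.
have Ns : N (simplex_coef r a s).
  by rewrite /simplex_coef; case: transporter => [g|] //=; exact: Nr.
have Nn (k : nat) : N (simplex_coef r a s *+ k).
  by elim: k => [|k IHk]; rewrite ?mulr0n// mulrS; exact: ND.
by case: (coeff s c) => k; [exact: Nn|apply: NN; exact: Nn].
Qed.

End Module.

(** Naturality in the module serves twice: to pass between classes and functions, and to pull back
    along an equivariant map. *)
Lemma orbit_coef_natural (A A' : zmodType) (ract : A -> Gam -> A)
    (ract' : A' -> Gam -> A') (f : A -> A') r a c :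
  {morph f : x y / x - y} -> (forall x g, f (ract x g) = ract' (f x) g) ->
  f (orbit_coef ract r a c) = orbit_coef ract' r (f a) c.
Proof.
move=> fB fr; rewrite /orbit_coef morphB_sum//; apply: eq_bigr => s _.
rewrite morphBz// /simplex_coef.
by case: transporter => [g|] /=; rewrite ?fr// morphB0.
Qed.

End OrbitCoefficients.

(** * Random equivariant maps to the Bernoulli shift *)

Section DiscreteFunctions.
Context (d : measure_display) (X : measurableType d).

Definition int_measurable (f : X -> int) :=
  forall A : set int, measurable (f @^-1` A).

Lemma int_measurable_comp (T : Type) (f : X -> int) (F : int -> T) (A : set T) :
  int_measurable f -> measurable ((F \o f) @^-1` A).
Proof. by move=> mf; rewrite comp_preimage; exact: mf. Qed.

Lemma int_measurable2 (F : int -> int -> int) (f g : X -> int) :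
  int_measurable f -> int_measurable g ->
  int_measurable (fun x => F (f x) (g x)).
Proof.
move=> mf mg A; rewrite (_ : _ @^-1` A =
    \bigcup_(z : int) (f @^-1` [set z] `&` g @^-1` [set w | A (F z w)])).
  apply: countable_bigcupT_measurable => [|z]; first exact: countableP.
  by apply: measurableI; [exact: mf|exact: mg].
apply/seteqP; split=> [x Ax|x [z _ [/= <-]]//].
by exists (f x).
Qed.

Lemma int_measurable_cst (z : int) : int_measurable (cst z).
Proof.
move=> A; have [Az|Az] := pselect (A z).
  by rewrite (_ : _ @^-1` _ = setT)//; apply/seteqP; split.
by rewrite (_ : _ @^-1` _ = set0)//; apply/seteqP; split.
Qed.

Lemma int_measurable_fun (d' : measure_display) (Y : measurableType d')
    (f : X -> int) (F : int -> Y) :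
  int_measurable f -> measurable_fun setT (F \o f).
Proof. by move=> mf _ A _; rewrite setTI; exact: int_measurable_comp. Qed.

End DiscreteFunctions.

Section L1norm.
Context (R : realType) (d : measure_display) (X : measurableType d).
Variable mu : probability X R.

Definition abse_int (z : int) : \bar R := (`|z|%N%:R)%:E.

Lemma abse_int_ge0 z : (0 <= abse_int z)%E.
Proof. by rewrite lee_fin. Qed.

Definition L1norm (f : X -> int) : \bar R := (\int[mu]_x abse_int (f x))%E.

Lemma measurable_abse_int (f : X -> int) :
  int_measurable f -> measurable_fun setT (fun x => abse_int (f x)).
Proof. exact: (@int_measurable_fun _ X _ _ f abse_int). Qed.

Lemma L1norm_ge0 f : (0 <= L1norm f)%E.
Proof. by apply: integral_ge0 => x _; exact: abse_int_ge0. Qed.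

Lemma L1norm_ae (f g : X -> int) :
  int_measurable f -> int_measurable g ->
  (\forall x \ae mu, f x = g x) -> L1norm f = L1norm g.
Proof.
move=> mf mg fg; apply: ae_eq_integral => //.
- exact: measurable_abse_int.
- exact: measurable_abse_int.
- by apply: filterS fg => x -> _.
Qed.

Lemma L1normD (f g : X -> int) : int_measurable f -> int_measurable g ->
  (L1norm (fun x => f x + g x)%R <= L1norm f + L1norm g)%E.
Proof.
move=> mf mg; rewrite -ge0_integralD//; last 4 first.
- by move=> *; exact: abse_int_ge0.
- exact: measurable_abse_int.
- by move=> *; exact: abse_int_ge0.
- exact: measurable_abse_int.
apply: ge0_le_integral => //.
- by move=> *; exact: abse_int_ge0.
- by apply: measurable_abse_int; exact: (int_measurable2 +%R).
- by apply: emeasurable_funD; exact: measurable_abse_int.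
- move=> x _; rewrite /abse_int -EFinD lee_fin -natrD ler_nat; lia.
Qed.

End L1norm.

(** * Invariance of the product law under injective reindexing *)

Section ProductLaw.
Context (R : realType) (Gam : groupType) (d : measure_display).
Context (B : measurableType d) (beta : probability B R).
Variable P : probability (bernoulli_space Gam B) R.
Hypothesis HP : product_measure beta P.

Local Notation Om := (bernoulli_space Gam B).

Let box : set (set Om) := [set C | exists A : Gam -> set B,
  [/\ forall g, measurable (A g), exists s : seq Gam, forall g, g \notin s -> A g = setT
    & C = [set w | forall g, A g (w g)]]].

Let boxI : setI_closed box.
Proof.
move=> _ _ [A [mA [s sA] ->]] [A' [mA' [s' sA'] ->]].
exists (fun g => A g `&` A' g); split.
- by move=> g; exact: measurableI.
- exists (s ++ s') => g; rewrite mem_cat negb_or => /andP[gs gs'].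
  by rewrite sA// sA'// setTI.
- apply/seteqP; split=> w /=; first by move=> [wA wA'] g; split.
  by move=> wA; split=> g; have [] := wA g.
Qed.

Let boxE : measurable = <<s box >> :> set (set Om).
Proof.
apply/seteqP; split.
  apply: smallest_sub; first exact: smallest_sigma_algebra.
  move=> _ [k [A [mA ->]]]; apply: sub_sigma_algebra.
  exists (fun g => if g == k then A else setT); split.
  - by move=> g; case: ifP.
  - by exists [:: k] => g; rewrite inE => /negbTE ->.
  - apply/seteqP; split=> w /= wA; last by have := wA k; rewrite eqxx.
    by move=> g; case: eqP => // ->.
apply: smallest_sub; first exact: sigma_algebra_measurable.
move=> _ [A [mA [s sA] ->]].
rewrite (_ : [set _ | _] = \big[setI/setT]_(g <- s) [set w : Om | A g (w g)]).
  apply: bigsetI_measurable => g _.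
  by apply: sub_sigma_algebra; exists g, (A g).
rewrite -bigcap_seq; apply/seteqP; split=> w /= wA g; first by move=> _; exact: wA.
by have [/wA//|/sA ->] := boolP (g \in s).
Qed.

Lemma measurable_coordinate (g : Gam) (A : set B) :
  measurable A -> measurable [set w : Om | A (w g)].
Proof. by move=> mA; apply: sub_sigma_algebra; exists g, A. Qed.

Lemma measurable_to_bernoulli d' (Y : measurableType d') (f : Y -> Om) :
  (forall g (A : set B), measurable A -> measurable [set y | A (f y g)]) ->
  measurable_fun setT f.
Proof.
move=> mf; have := @measurability _ _ _ _ setT f (@coordinate_sets Gam _ B) erefl.
apply.
by move=> _ [_ [g [A [mA ->]]] <-]; rewrite setTI; exact: mf.
Qed.

Lemma box_probability (s : seq Gam) (t : Gam -> Gam) (A : Gam -> set B) :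
  uniq s -> {in s &, injective t} -> (forall g, measurable (A g)) ->
  P [set w | forall g, g \in s -> A g (w (t g))] = (\prod_(g <- s) beta (A g))%E.
Proof.
move=> us tinj mA.
(* A left inverse of [t] on [s], extended by the identity. *)
pose t' h := if pselect (exists2 g, g \in s & t g = h) is left e then projT1 (cid2 e) else h.
have t'K g : g \in s -> t' (t g) = g.
  move=> gs; rewrite /t'; case: pselect => [e|[]]; last by exists g.
  by case: (cid2 e) => /= x xs; exact: tinj.
have uts : uniq (map t s) by rewrite map_inj_in_uniq.
rewrite (_ : [set w | _] = [set w | forall g, g \in map t s -> A (t' g) (w g)]).
  rewrite (HP (A := A \o t') uts) => [|g]; last exact: mA.
  rewrite big_map.
  by rewrite big_seq [RHS]big_seq; apply: eq_bigr => g gs /=; rewrite t'K.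
apply/seteqP; split=> w /= wA; last by move=> g gs; have := wA _ (map_f t gs); rewrite t'K.
by move=> _ /mapP[g gs ->]; rewrite t'K//; exact: wA.
Qed.

Definition depends_on (T : Type) (F : seq Gam) (f : Om -> T) :=
  forall w w' : Om, {in F, w =1 w'} -> f w = f w'.

(** As [t] is injective on [F] only, [w \o t] need not have law [P]. The two laws compared are
    therefore those obtained by freezing all coordinates outside [F]; they agree on boxes. *)
Lemma integral_reindex (F : seq Gam) (t : Gam -> Gam) (f : Om -> \bar R) :
  {in F &, injective t} -> depends_on F f -> measurable_fun setT f ->
  (forall w, 0 <= f w)%E ->
  (\int[P]_w f (w \o t) = \int[P]_w f w)%E.
Proof.
move=> tinj fF mf f0.
(* Total mass 1 gives a point of [Om], hence the value [b0] at which coordinates are frozen. *)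
have [w0 _] : [set: Om] !=set0.
  apply/set0P/eqP => E; have := @probability_setT _ _ _ P.
  by rewrite E measure0 => /eqP; rewrite lt_eqF.
have [b0] : inhabited B by exact: inhabits (w0 1%g).
pose r (u : Gam -> Gam) (w : Om) : Om := fun g => if g \in F then w (u g) else b0.
have mr u : measurable_fun setT (r u).
  apply: measurable_to_bernoulli => g A mA; rewrite /r.
  case: (g \in F); first exact: measurable_coordinate.
  have [Ab|Ab] := pselect (A b0).
    by rewrite (_ : [set _ | _] = setT)//; apply/seteqP; split.
  by rewrite (_ : [set _ | _] = set0)//; apply/seteqP; split.
have fr u w : f (w \o u) = f (r u w).
  by apply: fF => g gF; rewrite /r gF.
have E u : (\int[P]_w f (w \o u) = \int[pushforward P (r u)]_w f w)%E.
  rewrite ge0_integral_pushforward// preimage_setT.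
  by apply: eq_integral => w _; rewrite fr.
rewrite (E t) -[RHS]/(\int[P]_w f (w \o id))%E (E id).
apply: eq_measure_integral => C mC _.
apply: (@measure_unique _ R Om box (fun=> setT) boxE boxI) => //.
- by move=> _; exists (fun=> setT); split=> //; [exists [::]|apply/seteqP; split].
- exact: bigcup_const.
- move=> _ [A [mA _ ->]].
  have rA u : {in F &, injective u} -> pushforward P (r u) [set w | forall g, A g (w g)] =
      if `[< forall g, g \notin F -> A g b0 >] then (\prod_(g <- undup F) beta (A g))%E
      else 0%E.
    move=> uinj; rewrite /pushforward; case: asboolP => Ab0.
      rewrite -(@box_probability _ u) ?undup_uniq//; last first.
        by move=> x y; rewrite !mem_undup; exact: uinj.
      congr (P _); apply/seteqP; split=> w /= wA g; rewrite /r.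
        by rewrite mem_undup => gF; have := wA g; rewrite /r gF.
      by case: ifPn => gF; [apply: wA; rewrite mem_undup|exact: Ab0].
    rewrite (_ : _ @^-1` _ = set0) ?measure0//; apply/seteqP; split=> w //= wA.
    by apply: Ab0 => g gF; have := wA g; rewrite /r (negbTE gF).
  by transitivity (pushforward P (r id) [set w | forall g, A g (w g)]);
    [rewrite -[LHS]/(pushforward P (r t) _) !rA|].
- move=> _; rewrite [X in (X < _)%E](_ : _ = 1%E) ?ltry//.
  exact: (@probability_setT _ _ _ P).
Qed.

End ProductLaw.

(** * Approximation by functions of finitely many coordinates *)

Section Approximation.
Context (R : realType) (Gam : groupType) (d : measure_display).
Context (B : measurableType d).
Variable P : probability (bernoulli_space Gam B) R.

Local Notation Om := (bernoulli_space Gam B).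

Definition finitary (T : Type) (f : Om -> T) := exists F : seq Gam, depends_on F f.

Lemma finitary2 (T T' T'' : Type) (F : T -> T' -> T'') (f : Om -> T) (f' : Om -> T') :
  finitary f -> finitary f' -> finitary (fun w => F (f w) (f' w)).
Proof.
move=> [s sf] [s' sf']; exists (s ++ s') => w w' ww'; congr F.
  by apply: sf => g gs; apply: ww'; rewrite mem_cat gs.
by apply: sf' => g gs; apply: ww'; rewrite mem_cat gs orbT.
Qed.

Let symdiff (E A : set Om) : set Om := (E `\` A) `|` (A `\` E).

Let measurable_symdiff E A :
  measurable E -> measurable A -> measurable (symdiff E A).
Proof. by move=> mE mA; apply: measurableU; exact: measurableD. Qed.

Let le_measureU A E E' : measurable A -> measurable E -> measurable E' ->
  A `<=` E `|` E' -> (P A <= P E + P E')%E.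
Proof.
move=> mA mE mE' AE; apply: (@le_trans _ _ (P (E `|` E'))).
  by apply: le_measure => //; rewrite inE//; exact: measurableU.
exact: measureU2.
Qed.

Definition approximable : set (set Om) := [set E | measurable E /\
  forall e : R, 0 < e -> exists A : set Om,
    [/\ measurable A, finitary A & (P (symdiff E A) <= e%:E)%E]].

Lemma approximableU E E' :
  approximable E -> approximable E' -> approximable (E `|` E').
Proof.
move=> [mE aE] [mE' aE']; split; first exact: measurableU.
move=> e e0; have e2 : 0 < e / 2 by rewrite divr_gt0.
have [A [mA fA EA]] := aE _ e2; have [A' [mA' fA' EA']] := aE' _ e2.
exists (A `|` A'); split; first exact: measurableU.
  exact: (finitary2 or fA fA').
rewrite [e]splitr EFinD; apply: le_trans (leeD EA EA').
apply: le_measureU; try exact: measurable_symdiff.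
  by apply: measurable_symdiff; exact: measurableU.
by rewrite /symdiff => w /=; tauto.
Qed.

Let approximable0 : approximable set0.
Proof.
split=> // e e0; exists set0; split=> //; first by exists [::].
by rewrite /symdiff setDv setU0 measure0 lee_fin ltW.
Qed.

(** By continuity from above some finite union exhausts the whole union up to [e / 2]; the other
    half pays for approximating the finite union. *)
Lemma approximable_bigcup (E : nat -> set Om) :
  (forall n, approximable (E n)) -> approximable (\bigcup_n E n).
Proof.
move=> aE; have mE n : measurable (E n) by have [] := aE n.
have mU : measurable (\bigcup_n E n) by exact: bigcup_measurable.
split=> // e e0; have e2 : 0 < e / 2 by rewrite divr_gt0.
pose U n := \big[setU/set0]_(i < n) E i.
have aU n : approximable (U n).
  by apply: big_ind => [|? ? |i _]; [exact: approximable0|exact: approximableU|exact: aE].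
have mUn n : measurable (U n) by have [] := aU n.
have [n Un] : exists n, (P (\bigcup_n E n `\` U n) <= (e / 2)%:E)%E.
  have : P (\bigcup_n E n `\` U n) @[n --> \oo] --> P set0.
    have <- : \bigcap_n (\bigcup_n E n `\` U n) = set0.
      apply/seteqP; split=> // w wU; have [[k _ Ek] _] := wU 0%N I.
      have [_] := wU k.+1 I; apply.
      by rewrite /U big_ord_recr /=; right.
    apply: nonincreasing_cvg_mu.
    - by rewrite ltey_eq fin_num_measure//; exact: measurableD.
    - by move=> n; exact: measurableD.
    - by apply: bigcap_measurable => // n _; exact: measurableD.
    - apply/nonincreasing_seqP => n; apply/subsetPset => w [wE wU]; split=> //.
      by move=> Uw; apply: wU; rewrite /U big_ord_recr; left.
  rewrite measure0 => /fine_cvgP[+ /cvgrPdist_le /(_ _ e2)].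
  move=> fn [m _ Hm]; case: fn => m' _ Hm'.
  exists (maxn m m').
  have := Hm (maxn m m') (leq_maxl _ _); have := Hm' (maxn m m') (leq_maxr _ _).
  rewrite /= sub0r normrN => fP Pe.
  by rewrite -(fineK fP) lee_fin; exact: le_trans (ler_norm _) Pe.
have [A [mA fA UA]] := (aU n).2 _ e2.
exists A; split=> //; rewrite [e]splitr EFinD; apply: le_trans (leeD Un UA).
apply: le_measureU.
+ exact: measurable_symdiff.
+ exact: measurableD.
+ exact: measurable_symdiff.
+ have UE : U n `<=` \bigcup_n E n.
    by rewrite /U -bigcup_mkord => w [k _ Ek]; exists k.
  move=> w; move: (UE w) (EM (U n w)); rewrite /symdiff /setU /setD /=.
  by move: ((\bigcup_n E n) w) => Ew; tauto.
Qed.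

(** The approximable sets form a sigma-algebra that contains the generating coordinate sets. *)
Lemma approximable_measurable E : measurable E -> approximable E.
Proof.
move: E; apply: smallest_sub; last first.
  move=> _ [g [A [mA ->]]]; split; first exact: measurable_coordinate.
  move=> e e0; exists [set w | A (w g)]; split; first exact: measurable_coordinate.
    by exists [:: g] => w w' ww' /=; rewrite ww'// inE.
  by rewrite /symdiff setDv setU0 measure0 lee_fin ltW.
split; first exact: approximable0.
- move=> E [mE aE]; rewrite setTD; split; first exact: measurableC.
  move=> e /aE [A [mA fA EA]]; exists (~` A); split; first exact: measurableC.
    exact: (finitary2 (fun p _ => ~ p) fA fA).
  rewrite (_ : symdiff _ _ = symdiff E A)//.
  by apply/seteqP; split=> w; move: (EM (E w)) (EM (A w)); rewrite /symdiff /=; tauto.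
- exact: approximable_bigcup.
Qed.

(** The bound holds at every point and not just almost everywhere, so it survives composition with
    any map into [Om]. *)
Definition cylindrical (f : Om -> int) :=
  [/\ int_measurable f, finitary f & exists K : nat, forall w, (`|f w| <= K)%N].

Lemma cylindrical_cst z : cylindrical (cst z).
Proof.
split; [exact: int_measurable_cst|by exists [::]|].
by exists `|z|%N.
Qed.

Lemma cylindricalB f f' : cylindrical f -> cylindrical f' ->
  cylindrical (fun w => f w - f' w).
Proof.
move=> [mf ff [K fK]] [mf' ff' [K' fK']]; split.
- exact: (int_measurable2 (fun a b => a - b)).
- exact: (finitary2 (fun a b => a - b)).
- exists (K + K')%N => w; have := fK w; have := fK' w; lia.
Qed.

Lemma cylindricalD f f' : cylindrical f -> cylindrical f' ->
  cylindrical (fun w => f w + f' w).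
Proof.
move=> [mf ff [K fK]] [mf' ff' [K' fK']]; split.
- exact: (int_measurable2 +%R).
- exact: (finitary2 +%R).
- exists (K + K')%N => w; have := fK w; have := fK' w; lia.
Qed.

Lemma cylindrical_shift f g : cylindrical f -> cylindrical (f \o Defs.shift g).
Proof.
move=> [mf [F fF] [K fK]]; split.
- move=> A; have := @measurable_shift _ _ B g measurableT _ (mf A).
  by rewrite setTI.
- exists [seq (g^-1 * k)%g | k <- F] => w w' ww' /=; apply: fF => k kF.
  by rewrite /Defs.shift; apply: ww'; exact: map_f.
- by exists K => w; exact: fK.
Qed.

Definition L1_approximable (f : Om -> int) := int_measurable f /\
  forall e : R, 0 < e -> exists f', cylindrical f' /\
    (L1norm P (fun w => f w - f' w)%R <= e%:E)%E.

Lemma L1_approximable_cst z : L1_approximable (cst z).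
Proof.
split=> [|e e0]; first exact: int_measurable_cst.
exists (cst z); split; first exact: cylindrical_cst.
rewrite /L1norm; under eq_integral do rewrite subrr.
by rewrite integral0 lee_fin ltW.
Qed.

Lemma L1_approximableD f f' : L1_approximable f -> L1_approximable f' ->
  L1_approximable (fun w => f w + f' w).
Proof.
move=> [mf af] [mf' af']; split; first exact: (int_measurable2 +%R).
move=> e e0; have e2 : 0 < e / 2 by rewrite divr_gt0.
have [g [cg fg]] := af _ e2; have [g' [cg' fg']] := af' _ e2.
exists (fun w => g w + g' w); split; first exact: cylindricalD.
rewrite [e]splitr EFinD; apply: le_trans (leeD fg fg').
have [mg _ _] := cg; have [mg' _ _] := cg'.
rewrite (_ : (fun w => _) = (fun w => (f w - g w) + (f' w - g' w))).
  by apply: L1normD; exact: (int_measurable2 (fun a b => a - b)).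
by apply/funext => w; rewrite opprD addrACA.
Qed.

(** The distance between two indicators is the measure of the symmetric difference. *)
Lemma L1_approximable_indic (E : set Om) : measurable E ->
  L1_approximable (fun w => Posz `[< E w >]).
Proof.
have dm (A : set Om) : measurable A -> int_measurable (fun w => Posz `[< A w >]).
  move=> mA C.
  rewrite (_ : _ @^-1` C = (A `&` [set w | C 1]) `|` (~` A `&` [set w | C 0])).
    have mC (Q : Prop) : measurable [set w : Om | Q].
      have [q|q] := pselect Q.
        by rewrite (_ : [set _ | _] = setT)//; apply/seteqP; split.
      by rewrite (_ : [set _ | _] = set0)//; apply/seteqP; split.
    by apply: measurableU; apply: measurableI => //; exact: measurableC.
  by apply/seteqP; split=> w /=; case: asboolP => //=; tauto.
move=> mE; split; first exact: dm.
move=> e e0; have [_ /(_ _ e0)[A [mA fA EA]]] := approximable_measurable mE.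
exists (fun w => Posz `[< A w >]); split.
  split; first exact: dm.
  - exact: (finitary2 (fun p _ => Posz `[< p >]) fA fA).
  - by exists 1%N => w; case: asboolP.
apply: le_trans EA; rewrite -(setIT (symdiff E A)) -integral_indic//; last first.
  exact: measurable_symdiff.
rewrite le_eqVlt; apply/orP; left; apply/eqP; apply: eq_integral => w _.
rewrite /abse_int indicE; congr (_%:R)%:E.
rewrite /symdiff in_setU !in_setD -[w \in E]/(`[< E w >]) -[w \in A]/(`[< A w >]).
by case: asbool; case: asbool.
Qed.

(** Layer-cake decomposition: [f + K] takes values in [[0, 2K]], hence is the sum over [i < K + K]
    of the indicators of [i < f + K]. *)
Lemma L1_approximable_bounded (f : Om -> int) (K : nat) :
  int_measurable f -> (forall w, (`|f w| <= K)%N) -> L1_approximable f.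
Proof.
move=> mf fK.
have -> : f = (fun w => \sum_(i < K + K) Posz `[< (i%:Z < f w + K%:Z)%R >] + - K%:Z).
  apply/funext => w; have := fK w.
  move En : (absz (f w + K%:Z)) => n fw.
  have -> : f w = n%:Z - K%:Z by lia.
  have nK : (n <= K + K)%N by lia.
  rewrite subrK; congr (_ - _).
  under eq_bigr do rewrite ltz_nat asboolb.
  elim: (K + K)%N nK => [|m IHm]; first by rewrite leqn0 => /eqP ->; rewrite big_ord0.
  rewrite big_ord_recr /= leq_eqVlt => /predU1P[->|nm].
    rewrite ltnSn (eq_bigr (fun=> 1)) => [|i _]; last by rewrite ltnS ltnW.
    by rewrite sumr_const card_ord; lia.
  by rewrite -IHm// ltnNge -ltnS nm addr0.
apply: (@L1_approximableD (fun w => \sum_(i < K + K) Posz `[< (i%:Z < f w + K%:Z)%R >])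
  (cst (- K%:Z))); last exact: L1_approximable_cst.
elim: (K + K)%N => [|m IHm].
  rewrite (_ : (fun w => _) = cst 0); first exact: L1_approximable_cst.
  by apply/funext => w; rewrite big_ord0.
rewrite (_ : (fun w => _) = (fun w =>
    \sum_(i < m) Posz `[< (i%:Z < f w + K%:Z)%R >] + Posz `[< (m%:Z < f w + K%:Z)%R >])).
  apply: L1_approximableD => //.
  apply: (@L1_approximable_indic [set w | (m%:Z < f w + K%:Z)%R]).
  exact: (mf [set z | (m%:Z < z + K%:Z)%R]).
by apply/funext => w; rewrite big_ord_recr.
Qed.

Lemma L1_approximable_ess_bounded (f : ess_bounded P) : L1_approximable (val f).
Proof.
have /asboolP[mf [K fK]] := valP f.
pose f' w := if (`|val f w| <= K)%N then val f w else 0.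
have mf' : int_measurable f'.
  by move=> A; exact: (@int_measurable_comp _ _ _ _
    (fun z => if (`|z| <= K)%N then z else 0) A mf).
have [|_ af'] := @L1_approximable_bounded f' K mf'.
  by move=> w; rewrite /f'; case: ifP.
split=> // e e0; have [g [cg f'g]] := af' _ e0; exists g; split=> //.
rewrite (@L1norm_ae _ _ _ P _ (fun w => f' w - g w))//.
- by have [mg _ _] := cg; exact: (int_measurable2 (fun a b => a - b)).
- by have [mg _ _] := cg; exact: (int_measurable2 (fun a b => a - b)).
- by apply: filterS fK => w fw; rewrite /f' fw.
Qed.

End Approximation.

Lemma infinite_set_injection (T : Type) :
  infinite_set [set: T] -> exists f : nat -> T, injective f.
Proof.
move=> /infiniteP /asboolP [f].
exists (fun n => val (f (exist _ n (mem_set (I : [set: nat] n))))) => x y /val_inj.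
move=> /(@inj _ _ _ f) E.
by have [] := E (mem_set I) (mem_set I).
Qed.

(** The sets are the preimages of a countable base, which separates points by the Hausdorff
    property. *)
Lemma standard_borel_separated (R : realType) (d : measure_display) (X : measurableType d) :
  standard_borel R X -> exists A : nat -> set X,
    (forall n, measurable (A n)) /\ forall x y, (forall n, A n x <-> A n y) -> x = y.
Proof.
move=> [T [f [hT [Bs /countable_injP[c cinj] [Bo Bn]] [_ fi fs] fm]]].
(* The union has at most one member, the base set with code [n], and is empty if [n] is not a
   code. *)
exists (fun n => f @^-1` \bigcup_(U in [set U | Bs U /\ c U = n]) U); split=> [n|x y xy].
  apply/fm; apply: sub_sigma_algebra.
  have -> (U : set T) : f @` (f @^-1` U) = U.
    by apply: image_preimage; apply/seteqP; split=> // t _; exact: fs.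
  by apply: bigcup_open => U [BU _]; exact: Bo.
apply: fi; rewrite ?inE//; apply: contrapT => /eqP fxy.
have /= := hT; rewrite open_hausdorff => /(_ _ _ fxy)[[U V] /= [fxU fyV] [oU _ UV]].
have [W [BW Wx] WU] := Bn (f x) _ (open_nbhs_nbhs (conj oU (set_mem fxU))).
have [/(_ _)[|W' [BW' cW'] W'y]] := xy (c W); first by exists W.
have WW : W' = W by apply: cinj; rewrite ?inE.
have : (U `&` V) (f y).
  by split; [apply: WU; rewrite /= -WW|exact: set_mem fyV].
by move/eqP: UV => ->.
Qed.

(** * Transfer from the Bernoulli shift to a free action *)

Section Transfer.
Context (R : realType) (Gam : groupType) (d : measure_display) (B : measurableType d).
Variables (beta : probability B R) (P : probability (bernoulli_space Gam B) R).
Hypothesis HP : product_measure beta P.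
Context (dX : measure_display) (X : measurableType dX) (mu : probability X R).
Variable alpha : gamma_space Gam mu.
Hypotheses (Xborel : standard_borel R X) (alpha_free : essentially_free alpha).
Hypothesis Gam_infinite : infinite_set [set: Gam].

Local Notation Om := (bernoulli_space Gam B).

Lemma gact_inj g h x : alpha g^-1%g x = alpha h^-1%g x -> alpha (h * g^-1)%g x = x.
Proof. by move=> E; rewrite gactM E -gactM mulgV gact1. Qed.

Section Coloring.
Variable A : nat -> set X.
Hypothesis mA : forall n, measurable (A n).

(** A cell is encoded by its membership vector; these form a finite type, so cells can be numbered
    by [pickle]. *)
Definition cell (N : nat) (x : X) : {ffun 'I_N -> bool} :=
  [ffun i : 'I_N => `[< A i x >]].
Arguments cell : clear implicits.

Lemma cellP N x y : cell N x = cell N y <-> forall i, (i < N)%N -> (A i x <-> A i y).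
Proof.
split=> [/ffunP xy i iN|xy].
  by have := xy (Ordinal iN); rewrite !ffunE => E; exact: asbool_eq_equiv E.
apply/ffunP => i; rewrite !ffunE; exact: asbool_equiv_eq (xy i (ltn_ord i)).
Qed.

Lemma measurable_cell N v : measurable [set x | cell N x = v].
Proof.
rewrite (_ : [set x | _] =
  \big[setI/setT]_(i < N) (if v i then A i else ~` A i)).
  by apply: bigsetI_measurable => i _; case: ifP => _; [|apply: measurableC].
rewrite -bigcap_seq; apply/seteqP; split=> x /= xv.
  move=> i _; rewrite -xv ffunE; case: asboolP => //.
apply/ffunP => i; rewrite ffunE; have := xv i; rewrite /= mem_index_enum => /(_ isT).
by case: (v i) => ?; [exact/asboolP|exact/asboolPn].
Qed.

(** The inverses match the map built below, whose coordinate at [g] is the colour of the translate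
    of [x] by [g^-1]. *)
Definition collision (N : nat) (gh : Gam * Gam) : set X :=
  [set x | cell N (alpha gh.1^-1%g x) = cell N (alpha gh.2^-1%g x)].

Lemma measurable_cell_act N g v : measurable [set x | cell N (alpha g x) = v].
Proof.
by have := gact_measurable alpha g measurableT (measurable_cell v); rewrite setTI.
Qed.

Lemma measurable_collision N gh : measurable (collision N gh).
Proof.
rewrite (_ : collision N gh = \bigcup_(v : {ffun 'I_N -> bool})
  ([set x | cell N (alpha gh.1^-1%g x) = v] `&` [set x | cell N (alpha gh.2^-1%g x) = v])).
  apply: countable_bigcupT_measurable => [|v]; first exact: countableP.
  by apply: measurableI; exact: measurable_cell_act.
apply/seteqP; split=> [x xc|x [v _ [/= E E']]]; last by rewrite /collision /= E E'.
by exists (cell N (alpha gh.1^-1%g x)).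
Qed.

Hypothesis Asep : forall x y, (forall n, A n x <-> A n y) -> x = y.

(** As [N] grows, the collision sets decrease to the points with two equal translates, which lie
    outside the free part [Y] and so form a null set. *)
Lemma collision_cvg gh : gh.1 != gh.2 -> forall e : R, 0 < e ->
  exists N, forall N', (N <= N')%N -> (mu (collision N' gh) <= e%:E)%E.
Proof.
move=> gh12 e e0.
have [Y [mY Y1 _ Yfree]] := alpha_free.
have : mu (collision N gh) @[N --> \oo] --> mu (\bigcap_N collision N gh).
  apply: nonincreasing_cvg_mu.
  - by rewrite ltey_eq fin_num_measure//; exact: measurable_collision.
  - by move=> n; exact: measurable_collision.
  - by apply: bigcap_measurable => // n _; exact: measurable_collision.
  - apply/nonincreasing_seqP => n; apply/subsetPset => x /cellP xc.
    by apply/cellP => i ni; apply: xc; exact: ltnW.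
have -> : mu (\bigcap_N collision N gh) = 0%E.
  apply/eqP; rewrite eq_le measure_ge0 andbT.
  have <- : mu (~` Y) = 0%E by rewrite probability_setC// Y1 subee.
  apply: le_measure; rewrite ?inE.
  - by apply: bigcap_measurable => // n _; exact: measurable_collision.
  - exact: measurableC.
  move=> x xc Yx; move/eqP: gh12; apply.
  have /gact_inj/(Yfree _ _ Yx) : alpha gh.1^-1%g x = alpha gh.2^-1%g x.
    by apply: Asep => n; have /cellP := xc n.+1 I; apply.
  by move/(congr1 (fun g => g * gh.1)%g); rewrite mulgVK mul1g.
move=> /fine_cvgP[+ /cvgrPdist_le /(_ _ e0)].
move=> [m _ Hm] [m' _ Hm']; exists (maxn m m') => N; rewrite geq_max => /andP[mN m'N].
have := Hm N mN; have := Hm' N m'N; rewrite /= sub0r normrN => Pe fP.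
by rewrite -(fineK fP) lee_fin; exact: le_trans (ler_norm _) Pe.
Qed.

Lemma collisions_cvg (L : seq (Gam * Gam)) : (forall gh, gh \in L -> gh.1 != gh.2) ->
  forall e : R, 0 < e -> exists N, forall N', (N <= N')%N ->
    (mu (\big[setU/set0]_(gh <- L) collision N' gh) <= e%:E)%E.
Proof.
elim: L => [|gh L IHL] Ln e e0.
  by exists 0%N => N _; rewrite big_nil measure0 lee_fin ltW.
have e2 : 0 < e / 2 by rewrite divr_gt0.
have [|N HN] := @collision_cvg gh _ _ e2; first by apply: Ln; rewrite mem_head.
have [|N' HN'] := IHL _ _ e2; first by move=> k kL; apply: Ln; rewrite in_cons kL orbT.
exists (maxn N N') => M; rewrite geq_max => /andP[/HN h /HN' h'].
rewrite big_cons [e]splitr EFinD; apply: le_trans (leeD h h').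
by apply: measureU2; [|apply: bigsetU_measurable => ? _]; exact: measurable_collision.
Qed.

End Coloring.

(** A random colouring of the cells of a fine partition of [X], with the values of
    [w] at [e v] as colour of the cell [v], induces an equivariant map from [X] to
    [B^Gam], whose finite-dimensional marginals are on average those of [P] as long
    as the cells of finitely many translates of a point are distinct. *)
Lemma cylindrical_transfer (h : Om -> int) : cylindrical h ->
  forall e : R, 0 < e -> exists Phi : X -> Om,
    [/\ measurable_fun setT Phi, forall g x, Phi (alpha g x) = Defs.shift g (Phi x)
      & (L1norm mu (h \o Phi) <= L1norm P h + e%:E)%E].
Proof.
move=> [mh [F hF] [K hK]] e e0.
have [A [mA Asep]] := standard_borel_separated Xborel.
have [c cinj] := infinite_set_injection Gam_infinite.
(* Collisions matter only between distinct coordinates read by [h]. *)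
pose L := [seq gh <- [seq (g, k) | g <- F, k <- F] | gh.1 != gh.2].
have e2 : 0 < e / 2 by rewrite divr_gt0.
(* The integrand is at most [K], so a bad set of this measure costs at most [e / 2]. The successor
   avoids a division by zero. *)
have d0 : 0 < e / 2 / K.+1%:R by rewrite divr_gt0// ltr0n.
have [|N /(_ _ (leqnn _)) badN] := @collisions_cvg A mA Asep L _ _ d0.
  by move=> gh; rewrite mem_filter => /andP[].
set bad := \big[setU/set0]_(gh <- L) _ in badN.
have mbad : measurable bad.
  by apply: bigsetU_measurable => gh _; exact: measurable_collision.
(* Since [Gam] is infinite, distinct cells receive distinct elements of [Gam], and the coordinates
   of [w] there serve as independent colours. *)
pose color x : Gam := c (pickle (cell A N x)).
pose Phi (w : Om) (x : X) : Om := fun g => w (color (alpha g^-1%g x)).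
have PhiE w g x : Phi w (alpha g x) = Defs.shift g (Phi w x).
  apply/funext => k; rewrite /Phi /Defs.shift -gactM; congr (w (color (alpha _ x))).
  by rewrite invgM invgK.
(* Joint measurability, needed for Tonelli, holds because each coordinate depends on [x] only
   through one of finitely many cells. *)
have mPhi2 : measurable_fun setT (fun xw : X * Om => Phi xw.2 xw.1).
  apply: measurable_to_bernoulli => g C mC.
  rewrite (_ : [set _ | _] = \bigcup_(v : {ffun 'I_N -> bool})
    ([set x | cell A N (alpha g^-1%g x) = v] `*` [set w : Om | C (w (c (pickle v)))])).
    apply: countable_bigcupT_measurable => [|v]; first exact: countableP.
    apply: measurableX; first exact: measurable_cell_act.
    exact: measurable_coordinate.
  apply/seteqP; split=> [[x w] /= wC|[x w] [v _ [/= E Cw]]].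
    by exists (cell A N (alpha g^-1%g x)).
  by rewrite /= /Phi /color E.
have mPhi w : measurable_fun setT (Phi w).
  exact: (measurableT_comp mPhi2 (measurable_pair2 w)).
pose G (xw : X * Om) := abse_int R (h (Phi xw.2 xw.1)).
have mG : measurable_fun setT G.
  exact: (measurableT_comp (measurable_abse_int mh) mPhi2).
have G0 xw : (0 <= G xw)%E by exact: abse_int_ge0.
have GK z : (`|z| <= K)%N -> (abse_int R z <= K%:R%:E)%E.
  by move=> zK; rewrite lee_fin ler_nat.
have L1K : (L1norm P h <= K%:R%:E)%E.
  apply: (@le_trans _ _ (\int[P]_w cst K%:R%:E w)%E).
    apply: ge0_le_integral => //.
    - by move=> w _; exact: abse_int_ge0.
    - exact: measurable_abse_int.
    - by move=> w _; exact: GK.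
  by rewrite integral_cst// [X in (_ * X)%E](@probability_setT _ _ _ P) mule1.
have L1fin : L1norm P h \is a fin_num.
  by rewrite ge0_fin_numE ?L1norm_ge0//; exact: le_lt_trans L1K (ltry _).
(* Off [bad] the coordinates in [F] are read at distinct labels, so the average over [w] is exactly
   the norm of [h]; on [bad] the bound [K] is used. *)
have inner x : (\int[P]_w G (x, w) <= L1norm P h + K%:R%:E * (\1_bad x)%:E)%E.
  have [xb|xb] := pselect (bad x).
    rewrite indicE mem_set// mule1; apply: le_trans (leeDr _ (L1norm_ge0 _ _)).
    apply: (@le_trans _ _ (\int[P]_w cst K%:R%:E w)%E); last first.
      by rewrite integral_cst// [X in (_ * X)%E](@probability_setT _ _ _ P) mule1.
    apply: ge0_le_integral => //.
    - exact: (measurableT_comp mG (measurable_pair1 x)).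
    - by move=> w _; exact: GK.
  rewrite indicE memNset// mule0 adde0 le_eqVlt; apply/orP; left; apply/eqP.
  pose t g := color (alpha g^-1%g x).
  have tinj : {in F &, injective t}.
    move=> g k gF kF /cinj /(pcan_inj pickleK) gk; apply/eqP; apply: contrapT => /negP gnk.
    apply: xb; rewrite /bad -bigcup_seq; exists (g, k) => //=.
    by rewrite mem_filter /= gnk; apply/allpairsP; exists (g, k).
  apply: (@integral_reindex R Gam d B beta P HP F t (fun w => abse_int R (h w)) tinj).
  - by move=> w w' ww'; rewrite (hF w w').
  - exact: measurable_abse_int.
  - by move=> w; exact: abse_int_ge0.
have mfG : measurable_fun setT (fun x => \int[P]_w G (x, w))%E.
  exact: (measurable_fun_fubini_tonelli_F (m2 := P)).
have total : (\int[P]_w \int[mu]_x G (x, w) <= L1norm P h + (e / 2)%:E)%E.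
  rewrite -(fubini_tonelli G mG G0).
  apply: (@le_trans _ _ (\int[mu]_x (L1norm P h + K%:R%:E * (\1_bad x)%:E))%E).
    apply: ge0_le_integral => //.
    - by move=> x _; exact: integral_ge0.
    - apply: emeasurable_funD => //; apply: measurable_funeM.
      exact/measurable_EFinP/measurable_indic.
  rewrite ge0_integralD; last 5 first.
  - by [].
  - by move=> x _; exact: L1norm_ge0.
  - by [].
  - by move=> x _; rewrite mule_ge0// lee_fin.
  - by apply: measurable_funeM; exact/measurable_EFinP/measurable_indic.
  rewrite (_ : \int[mu]_x L1norm P h = L1norm P h)%E; last first.
    by rewrite (integral_cst mu measurableT) [X in (_ * X)%E](@probability_setT _ _ _ mu) mule1.
  apply: leeD => //.
  rewrite ge0_integralZl_EFin//; last first.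
    exact/measurable_EFinP/measurable_indic.
  rewrite integral_indic// setIT.
  apply: (@le_trans _ _ (K%:R%:E * (e / 2 / K.+1%:R)%:E)%E).
    by apply: lee_wpmul2l => //; rewrite lee_fin.
  rewrite -EFinM lee_fin mulrCA ger_pMr// ler_pdivrMr ?ltr0n// mul1r ler_nat.
  exact: leqnSn.
(* If every [w] exceeded the bound, so would the average; as [L1norm P h] is finite, this
   contradicts [total]. *)
have [w Hw] : exists w, (\int[mu]_x G (x, w) <= L1norm P h + e%:E)%E.
  apply: contrapT => /forallNP Hw.
  have : (L1norm P h + e%:E <= L1norm P h + (e / 2)%:E)%E.
    apply: le_trans total.
    rewrite -[leLHS]mule1 -(@probability_setT _ _ _ P) -integral_cst//.
    apply: ge0_le_integral => //.
    - by move=> w _ /=; rewrite adde_ge0// ?L1norm_ge0// lee_fin ltW.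
    - exact: (measurable_fun_fubini_tonelli_G (m1 := mu)).
    - by move=> w _; apply: ltW; rewrite ltNge; apply/negP; exact: Hw.
  by rewrite leeD2lE// lee_fin; move: e0; lra.
by exists (Phi w).
Qed.

End Transfer.

(** * Comparison of norms *)

(** With [f := push p], this completes the simplices of a reduced chain to representatives of all
    orbits met by [l]. *)
Lemma uniq_map_extend (T T' : eqType) (f : T -> T') (s0 l : seq T) :
  uniq (map f s0) -> exists s1, uniq (map f (s0 ++ s1)) /\
    forall x, x \in l -> f x \in map f (s0 ++ s1).
Proof.
move=> us0; elim: l => [|a l [s1 [us1 ls1]]]; first by exists [::]; rewrite cats0.
have [fa|fa] := boolP (f a \in map f (s0 ++ s1)).
  by exists s1; split=> // x; rewrite inE => /predU1P[->|/ls1].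
exists (rcons s1 a); rewrite -rcons_cat map_rcons rcons_uniq fa us1; split=> // x.
by rewrite inE mem_rcons inE => /predU1P[->|/ls1 ->]; rewrite ?eqxx ?orbT.
Qed.

(** * Norms of finite sums and integer multiples *)

Section L1Sums.
Context (R : realType) (d : measure_display) (X : measurableType d).
Variable mu : probability X R.

Lemma int_measurable_sum (I : Type) (r : seq I) (F : I -> X -> int) :
  (forall i, int_measurable (F i)) -> int_measurable (\sum_(i <- r) F i).
Proof.
move=> mF; apply: (big_ind (@int_measurable _ X)) => //.
  exact: int_measurable_cst.
by move=> f g mf mg; exact: (int_measurable2 +%R mf mg).
Qed.

Lemma L1norm0 : L1norm mu (0 : X -> int) = 0%E.
Proof. by rewrite /L1norm -[RHS](@integral0 _ _ _ mu setT). Qed.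

Lemma L1norm_sum (I : Type) (r : seq I) (F : I -> X -> int) :
  (forall i, int_measurable (F i)) ->
  (L1norm mu (\sum_(i <- r) F i)%R <= \sum_(i <- r) L1norm mu (F i))%E.
Proof.
move=> mF; elim: r => [|i r IHr]; first by rewrite !big_nil L1norm0.
rewrite !big_cons; apply: le_trans (leeD (lexx _) IHr).
by apply: L1normD => //; exact: int_measurable_sum.
Qed.

(** Turning a sum of norms into the norm of one function allows a single colouring to control all
    coefficients together. *)
Lemma L1norm_sum_norm (I : Type) (r : seq I) (F : I -> X -> int) :
  (forall i, int_measurable (F i)) ->
  L1norm mu (fun x => \sum_(i <- r) `|F i x|) = (\sum_(i <- r) L1norm mu (F i))%E.
Proof.
move=> mF; rewrite -ge0_integral_sum//.
- apply: eq_integral => x _; elim: r => [|i r IHr]; first by rewrite !big_nil.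
  rewrite !big_cons -IHr /abse_int -EFinD -natrD; congr (_%:R)%:E.
  have S0 : 0 <= \sum_(j <- r) `|F j x| by exact: sumr_ge0.
  by move: (\sum_(j <- r) _) S0 (F i x) => S S0 z; rewrite -[RHS]/(absz z + absz S)%N; lia.
- by move=> i; exact: measurable_abse_int.
- by move=> i x _; exact: abse_int_ge0.
Qed.

Lemma L1normMz (f : X -> int) (k : int) : int_measurable f ->
  L1norm mu (f *~ k) = ((`|k|%N%:R)%:E * L1norm mu f)%E.
Proof.
move=> mf; rewrite -ge0_integralZl_EFin//.
- apply: eq_integral => x _; rewrite /abse_int -EFinM -natrM -abszM.
  congr (_%:R)%:E; congr absz.
  have fM (n : nat) : (f *+ n) x = n%:Z * f x.
    by elim: n => [|n IHn]; rewrite ?mulr0n ?mul0r// mulrS /= [LHS]/(f x + (f *+ n) x) IHn intS mulrDl mul1r.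
  case: k => n; first exact: fM.
  by rewrite -[LHS]/(- ((f *+ n.+1) x)) fM NegzE mulNr.
- by move=> *; exact: abse_int_ge0.
- exact: measurable_abse_int.
Qed.

End L1Sums.

(** * Actions on integer functions and on their classes *)

Section FunctionModule.
Variables (R : realType) (Gam : groupType).
Context (d : measure_display) (X : measurableType d) (mu : probability X R).
Variable alpha : gamma_space Gam mu.

(** Actual functions are used besides classes, because a map into [Om] along which one pulls back
    may not respect null sets. *)
Definition fun_act (f : X -> int) (g : Gam) : X -> int := f \o alpha g.

Lemma fun_actB g : {morph fun_act ^~ g : f f' / f - f'}.
Proof. by []. Qed.

Lemma int_measurable_act f g : int_measurable f -> int_measurable (fun_act f g).
Proof.
by move=> mf A; have := gact_measurable alpha g measurableT (mf A); rewrite setTI.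
Qed.

Lemma L1norm_act f g : int_measurable f -> L1norm mu (fun_act f g) = L1norm mu f.
Proof.
move=> mf; rewrite /L1norm.
transitivity (\int[pushforward mu (alpha g)]_x abse_int R (f x))%E.
  rewrite ge0_integral_pushforward//.
  - exact: gact_measurable.
  - exact: measurable_abse_int.
  - by move=> *; exact: abse_int_ge0.
apply: eq_measure_integral => [|mg A mA _]; first exact: gact_measurable.
exact: (gact_preserving alpha g mA).
Qed.

Lemma ess_bounded_measurable (f : ess_bounded mu) : int_measurable (val f).
Proof. by have /asboolP[] := valP f. Qed.

Lemma ess_bounded_actB g : {morph (ess_bounded_act alpha)^~ g : f f' / f - f'}.
Proof. by move=> f f'; apply: val_inj. Qed.

Lemma pi_LinfB : {morph \pi_(Linf mu) : f f' / f - f'}.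
Proof. exact: quot_piB. Qed.

Lemma Linf_actB g : {morph (Linf_act alpha)^~ g : a a' / a - a'}.
Proof.
move=> a a'; rewrite -[a]reprK -[a']reprK -pi_LinfB !Linf_act_pi -pi_LinfB.
by congr (\pi_(Linf mu) _); exact: ess_bounded_actB.
Qed.

Lemma Linf_act1 a : Linf_act alpha a 1%g = a.
Proof.
rewrite -[a in RHS]reprK /Linf_act; congr (\pi_(Linf mu) _).
by apply: val_inj; apply/funext => x /=; rewrite gact1.
Qed.

Lemma Linf_actM a g g' : Linf_act alpha a (g * g')%g = Linf_act alpha (Linf_act alpha a g) g'.
Proof.
rewrite -[Linf_act _ a g]/(\pi_(Linf mu) (ess_bounded_act alpha (repr a) g)).
rewrite Linf_act_pi; congr (\pi_(Linf mu) _).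
by apply: val_inj; apply/funext => x /=; rewrite gactM.
Qed.

Lemma Linf_act_one g : Linf_act alpha (Linf_one mu) g = Linf_one mu.
Proof. by rewrite Linf_act_pi; congr (\pi_(Linf mu) _); exact: val_inj. Qed.

Lemma integral_abs_pi (f : ess_bounded mu) :
  integral_abs (\pi_(Linf mu) f) = L1norm mu (val f).
Proof.
apply: L1norm_ae; [exact: ess_bounded_measurable|exact: ess_bounded_measurable|].
have : repr (\pi_(Linf mu) f) - f
    \in GRing.ZmodClosed.clone (ess_bounded mu) (@ae_zero _ _ _ mu) _.
  by rewrite Quotient.idealrBE reprK.
by move=> /asboolP; apply: filterS => x; rewrite raddfB => /eqP; rewrite subr_eq0 => /eqP.
Qed.

End FunctionModule.

Definition coef_norm (K : choiceType) (c : {freeg K}) : nat :=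
  (\sum_(k <- dom c) `|coeff k c|)%N.

Section OrbitCoefNorm.
Variables (R : realType) (Gam : groupType).
Context (d : measure_display) (X : measurableType d) (mu : probability X R).
Variable alpha : gamma_space Gam mu.
Variables (S : choiceType) (act : Gam -> S -> S).

Local Notation orbit_coef := (orbit_coef act (fun_act alpha)).

Lemma int_measurable_orbit_coef r f c :
  int_measurable f -> int_measurable (orbit_coef r f c).
Proof.
apply: orbit_coef_closed.
- exact: int_measurable_cst.
- by move=> g g'; exact: (int_measurable2 (fun a b => a - b)).
- exact: int_measurable_act.
Qed.

(** The action preserves the norm, so a simplex contributes at most the absolute value of its
    coefficient times the norm of [f]. *)
Lemma L1norm_orbit_coef r f c : int_measurable f ->
  (L1norm mu (orbit_coef r f c) <= (coef_norm c)%:R%:E * L1norm mu f)%E.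
Proof.
move=> mf.
have mc s : int_measurable (simplex_coef act (fun_act alpha) r f s).
  rewrite /simplex_coef; case: transporter => [g|] /=.
    exact: int_measurable_act.
  exact: int_measurable_cst.
have mcz s (k : int) : int_measurable (simplex_coef act (fun_act alpha) r f s *~ k).
  have -> : simplex_coef act (fun_act alpha) r f s *~ k =
      (fun x => simplex_coef act (fun_act alpha) r f s x * k).
    have E (n : nat) x : (simplex_coef act (fun_act alpha) r f s *+ n) x =
        simplex_coef act (fun_act alpha) r f s x * n%:Z.
      elim: n => [|n IHn]; rewrite ?mulr0n ?mulr0// mulrS.
      by rewrite [LHS]/(_ + (_ *+ n) x) IHn intS mulrDr mulr1.
    apply/funext => x; case: k => n; first exact: E.
    by rewrite -[LHS]/(- ((_ *+ n.+1) x)) E NegzE mulrN.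
  exact: (int_measurable2 (fun a _ => a * k) (mc s) (mc s)).
apply: (le_trans (L1norm_sum mu (dom c) (fun s => mcz s (coeff s c)))).
rewrite /coef_norm natr_sum -sumEFin ge0_sume_distrl; last by move=> *; rewrite lee_fin.
apply: lee_sum => s _; rewrite L1normMz//; apply: lee_wpmul2l; first by rewrite lee_fin.
rewrite /simplex_coef; case: transporter => [g|] /=; first by rewrite L1norm_act.
by rewrite L1norm0 L1norm_ge0.
Qed.

End OrbitCoefNorm.

(** * Singular simplices of the covering as a free set over their projections *)

Section SimplexAction.
Variables (R : realType) (Mt M : topologicalType) (p : continuousType Mt M).
Hypothesis puniv : universal_covering R p.
Variables (y0 : Mt) (Gam : groupType).
Variable cls : {path (unit_itv R) from (p y0) to (p y0)} -> Gam.
Hypothesis clsP : is_fundamental_group cls.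
Variable deck : Gam -> continuousType Mt Mt.
Hypothesis deckP : deck_action cls deck.
Variable k : nat.

Definition simplex_act (g : Gam) (s : simplex R k Mt) : simplex R k Mt := push (deck g) s.

Lemma simplex_act1 s : simplex_act 1%g s = s.
Proof. by have [deck1 _ _ _] := deckP; apply/continuousEP => t /=; rewrite deck1. Qed.

Lemma simplex_actM g g' s :
  simplex_act (g * g')%g s = simplex_act g (simplex_act g' s).
Proof. by have [_ deckM _ _] := deckP; apply/continuousEP => t /=; rewrite deckM. Qed.

Lemma push_simplex_act g s : push p (simplex_act g s) = push p s.
Proof. by have [_ _ deckp _] := deckP; apply/continuousEP => t /=; rewrite deckp. Qed.

Lemma simplex_act_free s g : simplex_act g s = s -> g = 1%g.
Proof. exact: (push_deck_free puniv clsP deckP). Qed.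

Lemma simplex_act_transitive s s' :
  push p s = push p s' -> exists g, simplex_act g s = s'.
Proof. exact: (push_deck_transitive puniv deckP). Qed.

Context (d : measure_display) (X : measurableType d) (mu : probability X R).
Variable alpha : gamma_space Gam mu.

Lemma param_tens_orbit_coef (rs : seq (simplex R k Mt)) f (c : chain R k Mt) :
  uniq (map (push p) rs) ->
  (forall s, s \in dom c -> push p s \in map (push p) rs) ->
  param_tens deck alpha f c =
  \sum_(r <- rs) param_tens deck alpha (orbit_coef simplex_act (Linf_act alpha) r f c) << r >>.
Proof.
apply: (tens_orbit_coef (act := simplex_act) (h := push p)).
- exact: simplex_act1.
- exact: simplex_actM.
- exact: simplex_act_free.
- exact: push_simplex_act.
- exact: simplex_act_transitive.
Qed.

Lemma param_tens_one_eq0 (c : chain R k Mt) :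
  chain_map p c = 0 -> param_tens deck alpha (Linf_one mu) c = 0.
Proof.
move=> pc; have [rs [urs crs]] := @uniq_map_extend _ _ (push p) [::] (dom c) isT.
rewrite (param_tens_orbit_coef _ urs crs) big1// => r _.
rewrite (orbit_coef_fixed (h := push p) simplex_act1 simplex_actM simplex_act_free
  push_simplex_act simplex_act_transitive
  _ _ (@Linf_act_one _ _ _ _ _ alpha)).
rewrite -[fglift _ c]/(chain_map p c) pc coeff0 mulr0z.
exact: (tens0l (Linf_act alpha)).
Qed.

End SimplexAction.

(** * Approximation and transfer of the coefficients of a cycle *)

Section Comparison.
Variables (R : realType) (n : nat) (Mt M : topologicalType) (o : orientation R n M).
Variable p : continuousType Mt M.
Hypothesis puniv : universal_covering R p.
Variables (y0 : Mt) (Gam : groupType).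
Variable cls : {path (unit_itv R) from (p y0) to (p y0)} -> Gam.
Hypothesis clsP : is_fundamental_group cls.
Variable deck : Gam -> continuousType Mt Mt.
Hypothesis deckP : deck_action cls deck.

Let act := @simplex_act R Mt Gam deck n.

Section Coefficients.
Context (d : measure_display) (X : measurableType d) (mu : probability X R).
Variable alpha : gamma_space Gam mu.

(** The coefficient at [r] of the chain [1 (x) z + \sum_l a l (x) boundary (c l)] *)
Definition cycle_coef (A : zmodType) (ract : A -> Gam -> A) (I : Type) (ls : seq I)
    (one : A) (z : chain R n Mt) (a : I -> A) (c : I -> chain R n.+1 Mt)
    (r : simplex R n Mt) : A :=
  orbit_coef act ract r one z + \sum_(l <- ls) orbit_coef act ract r (a l) (boundary (c l)).

Lemma cycle_coef_natural (A A' : zmodType) (ract : A -> Gam -> A)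
    (ract' : A' -> Gam -> A') (f : A -> A') (I : Type) (ls : seq I) one z a c r :
  {morph f : x y / x - y} -> (forall x g, f (ract x g) = ract' (f x) g) ->
  f (cycle_coef ract ls one z a c r) = cycle_coef ract' ls (f one) z (f \o a) c r.
Proof.
move=> fB fr; rewrite /cycle_coef morphBD// morphB_sum// (orbit_coef_natural _ _ _ _ fB fr).
by congr (_ + _); apply: eq_bigr => l _; rewrite (orbit_coef_natural _ _ _ _ fB fr).
Qed.

(** The coefficient formed from essentially bounded functions maps by naturality both to the one
    over [Linf] and to the one over plain functions. *)
Lemma integral_abs_cycle_coef (I : Type) (ls : seq I) one z a c r :
  integral_abs (cycle_coef (Linf_act alpha) ls (\pi_(Linf mu) one) z
    (fun l => \pi_(Linf mu) (a l)) c r) =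
  L1norm mu (cycle_coef (fun_act alpha) ls (val one) z (fun l => val (a l)) c r).
Proof.
have E1 := @cycle_coef_natural _ _ (ess_bounded_act alpha) (Linf_act alpha)
  \pi_(Linf mu) I ls one z a c r (@pi_LinfB _ _ _ mu).
rewrite -[fun l => _]/(\pi_(Linf mu) \o a) -E1 => [|f g]; last by rewrite Linf_act_pi.
rewrite integral_abs_pi; congr L1norm.
exact: (@cycle_coef_natural _ _ (ess_bounded_act alpha) (fun_act alpha) val).
Qed.

End Coefficients.

Context (dB : measure_display) (B : measurableType dB) (beta : probability B R).
Variable P : probability (bernoulli_space Gam B) R.
Hypothesis HP : product_measure beta P.
Context (d : measure_display) (X : measurableType d) (mu : probability X R).
Variable alpha : gamma_space Gam mu.
Hypotheses (Xborel : standard_borel R X) (alpha_free : essentially_free alpha).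
Hypothesis Gam_infinite : infinite_set [set: Gam].

Local Notation Om := (bernoulli_space Gam B).
Local Notation bern := (bernoulli_shift HP).

Lemma cycle_coef_transfer (rs : seq (simplex R n Mt)) (I : Type) (ls : seq I)
    (z : chain R n Mt) (g : I -> ess_bounded P) (c : I -> chain R n.+1 Mt) (e : R) :
  0 < e -> exists g' : I -> ess_bounded mu,
  (\sum_(r <- rs) L1norm mu (cycle_coef (fun_act alpha) ls (cst 1%R) z (fun l => val (g' l)) c r)
   <= \sum_(r <- rs) L1norm P (cycle_coef (fun_act bern) ls (cst 1%R) z (fun l => val (g l)) c r)
      + e%:E)%E.
Proof.
(* An error [delta] in every [g l] changes the sum of norms by at most [K] times [delta]. Half of
   [e] is spent on this, the other half on the colouring. *)
move=> e0; pose K := (size rs * \sum_(l <- ls) coef_norm (boundary (c l)))%N.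
have e2 : 0 < e / 2 by rewrite divr_gt0.
have d0 : 0 < e / 2 / K.+1%:R by rewrite divr_gt0// ltr0n.
have /choice[a aP] : forall l, exists f, cylindrical f /\
    (L1norm P (fun w => f w - val (g l) w)%R <= (e / 2 / K.+1%:R)%:E)%E.
  move=> l; have [_ /(_ _ d0)[f [fc fg]]] := L1_approximable_ess_bounded (g l).
  exists f; split=> //; apply: le_trans fg; rewrite le_eqVlt; apply/orP; left; apply/eqP.
  apply: eq_integral => w _; rewrite /abse_int; congr (_%:R)%:E; lia.
pose U r := cycle_coef (fun_act bern) ls (cst 1) z a c r.
pose V r := cycle_coef (fun_act bern) ls (cst 1%R) z (fun l => val (g l)) c r.
have cylU r : cylindrical (U r).
  have cyl_orbit f c' : cylindrical f -> cylindrical (orbit_coef act (fun_act bern) r f c').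
    apply: orbit_coef_closed; first exact: cylindrical_cst.
    - by move=> f1 f2; exact: cylindricalB.
    - by move=> f1 k; exact: cylindrical_shift.
  apply: cylindricalD; first by apply: cyl_orbit; exact: cylindrical_cst.
  apply: (big_ind (@cylindrical Gam dB B)).
  - exact: cylindrical_cst.
  - by move=> f1 f2; exact: cylindricalD.
  - by move=> l _; apply: cyl_orbit; have [] := aP l.
have mV r : int_measurable (V r).
  have mo f c' : int_measurable f -> int_measurable (orbit_coef act (fun_act bern) r f c').
    exact: int_measurable_orbit_coef.
  apply: (int_measurable2 +%R); first by apply: mo; exact: int_measurable_cst.
  by apply: int_measurable_sum => l; apply: mo; exact: ess_bounded_measurable.
have mU r : int_measurable (U r) by have [] := cylU r.
have UV r : (L1norm P (U r) <= L1norm P (V r) +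
    (\sum_(l <- ls) (coef_norm (boundary (c l)))%:R * (e / 2 / K.+1%:R))%:E)%E.
  pose D l := orbit_coef act (fun_act bern) r (a l - val (g l)) (boundary (c l)).
  have mD l : int_measurable (D l).
    apply: int_measurable_orbit_coef; apply: (int_measurable2 (fun x y => x - y)).
      by have [[]] := aP l.
    exact: ess_bounded_measurable.
  have -> : U r = V r + \sum_(l <- ls) D l.
    rewrite /U /V /cycle_coef -addrA -big_split /=; congr (_ + _).
    apply: eq_bigr => l _; rewrite /D orbit_coefBl; first by rewrite addrC subrK.
    exact: fun_actB.
  apply: le_trans (L1normD P (mV r) (int_measurable_sum ls mD)) _.
  apply: leeD => //; apply: le_trans (L1norm_sum P ls mD) _.
  rewrite -sumEFin; apply: lee_sum => l _; rewrite EFinM.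
  apply: le_trans (L1norm_orbit_coef bern _ _ _ _) _.
    apply: (int_measurable2 (fun x y => x - y)); last exact: ess_bounded_measurable.
    by have [[]] := aP l.
  by apply: lee_wpmul2l; [rewrite lee_fin|have [] := aP l].
have cyl_sum rs' : cylindrical (fun w => \sum_(r <- rs') `|U r w|).
  elim: rs' => [|r rs' IHrs].
    have -> : (fun w => \sum_(r <- [::]) `|U r w|) = cst 0.
      by apply/funext => w; rewrite big_nil.
    exact: cylindrical_cst.
  have -> : (fun w => \sum_(r <- r :: rs') `|U r w|) =
      (fun w => `|U r w| + \sum_(r <- rs') `|U r w|).
    by apply/funext => w; rewrite big_cons.
  apply: cylindricalD => //; have [mr fr [Kr rK]] := cylU r; split.
  - exact: (int_measurable2 (fun x _ => `|x|) mr mr).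
  - exact: (finitary2 (fun x _ => `|x|) fr fr).
  - by exists Kr => w; have := rK w; lia.
have [Phi [mPhi PhiE hPhi]] := cylindrical_transfer HP Xborel alpha_free Gam_infinite (cyl_sum rs) e2.
have bPhi l : ess_bounded_pred mu (a l \o Phi).
  have [[ma _ [Ka aK]] _] := aP l; apply/asboolP; split=> [C|].
    by have := mPhi measurableT _ (ma C); rewrite setTI.
  by exists Ka; apply: filterE => x; exact: aK.
pose g' l : ess_bounded mu := exist (ess_bounded_pred mu) _ (bPhi l).
(* Pullback along the equivariant [Phi] commutes with taking coefficients and preserves the constant
   1. *)
have UPhi r : cycle_coef (fun_act alpha) ls (cst 1) z (fun l => val (g' l)) c r = U r \o Phi.
  symmetry; apply: (@cycle_coef_natural _ _ (fun_act bern) (fun_act alpha) (fun u => u \o Phi)).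
    by [].
  by move=> u k; apply/funext => x /=; rewrite /fun_act /= PhiE.
exists g'.
have mUPhi r : int_measurable (U r \o Phi).
  by move=> C; have := mPhi measurableT _ (mU r C); rewrite setTI.
under eq_bigr do rewrite UPhi.
rewrite -(L1norm_sum_norm mu rs mUPhi).
apply: le_trans hPhi _; rewrite (L1norm_sum_norm P rs mU) [e]splitr EFinD addeA.
apply: leeD; last by rewrite -splitr.
pose eta := (\sum_(l <- ls) (coef_norm (boundary (c l)))%:R * (e / 2 / K.+1%:R) : R).
apply: (@le_trans _ _ (\sum_(r <- rs) (L1norm P (V r) + eta%:E))%E).
  by apply: lee_sum => r _; exact: UV.
rewrite big_split /=; apply: leeD => //.
rewrite sumEFin lee_fin /eta -mulr_suml -natr_sum big_const_seq count_predT iter_addr_0 -mulrnAl -mulrnA mulnC -/K.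
rewrite mulrCA ger_pMr// ler_pdivrMr ?ltr0n// mul1r ler_nat.
exact: leqnSn.
Qed.

End Comparison.

(** * Fundamental cycles and their reduced forms *)

Section Reduction.
Variables (R : realType) (n : nat) (Mt M : topologicalType) (o : orientation R n M).
Variable p : continuousType Mt M.
Hypothesis puniv : universal_covering R p.
Variables (y0 : Mt) (Gam : groupType).
Variable cls : {path (unit_itv R) from (p y0) to (p y0)} -> Gam.
Hypothesis clsP : is_fundamental_group cls.
Variable deck : Gam -> continuousType Mt Mt.
Hypothesis deckP : deck_action cls deck.
Context (d : measure_display) (X : measurableType d) (mu : probability X R).
Variable alpha : gamma_space Gam mu.
Variables (I : eqType) (ls : seq I) (z : chain R n Mt).
Variables (f : I -> Linf mu) (c : I -> chain R n.+1 Mt).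

Let act := @simplex_act R Mt Gam deck n.
Let act1 s : act 1%g s = s. Proof. exact: (simplex_act1 deckP). Qed.
Let actM g g' s : act (g * g')%g s = act g (act g' s). Proof. exact: (simplex_actM deckP). Qed.
Let act_free s g : act g s = s -> g = 1%g. Proof. 
exact: (simplex_act_free puniv clsP deckP). Qed.
Let push_act g s : push p (act g s) = push p s. Proof. exact: (push_simplex_act deckP). Qed.
Let act_transitive s s' : push p s = push p s' -> exists g, act g s = s'.
Proof. exact: (simplex_act_transitive puniv deckP). Qed.

Local Notation tens := (param_tens deck alpha).
Local Notation coef := (cycle_coef deck (Linf_act alpha) ls (Linf_one mu) z f c).
Local Notation total :=
  (tens (Linf_one mu) z + \sum_(l <- ls) tens (f l) (boundary (c l))).

Lemma cycle_coef_sum (rs : seq (simplex R n Mt)) : uniq (map (push p) rs) ->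
  (forall s, s \in dom z -> push p s \in map (push p) rs) ->
  (forall l, l \in ls -> forall s, s \in dom (boundary (c l)) -> push p s \in map (push p) rs) ->
  \sum_(r <- rs) tens (coef r) << r >> = total.
Proof.
move=> urs zrs crs.
rewrite (param_tens_orbit_coef puniv clsP deckP alpha _ urs zrs).
have -> : \sum_(l <- ls) tens (f l) (boundary (c l)) = \sum_(l <- ls) \sum_(r <- rs)
    tens (orbit_coef act (Linf_act alpha) r (f l) (boundary (c l))) << r >>.
  rewrite big_seq [RHS]big_seq; apply: eq_bigr => l /crs lrs.
  exact: (param_tens_orbit_coef puniv clsP deckP alpha _ urs lrs).
rewrite exchange_big -big_split; apply: eq_bigr => r _.
pose tr : Linf mu -> param_chain deck alpha n := fun a => tens a << r >>.
have trB : {morph tr : x y / x - y} := @tensBl _ _ _ (Linf_act alpha) _ << r >>.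
by rewrite -[LHS]/(tr _) /cycle_coef (morphBD trB) (morphB_sum trB).
Qed.

Lemma total_boundary : total - tens (Linf_one mu) z =
  param_boundary (\sum_(l <- ls) tens (f l) (c l)).
Proof.
rewrite addrAC subrr add0r.
rewrite (morphB_sum (@param_boundaryB R Mt Gam deck _ _ mu alpha n.+1)).
by apply: eq_bigr => l _; rewrite param_boundary_tens.
Qed.

(** The boundary of [1 (x) z] vanishes although [z] need not be a cycle in [Mt]: only the projection
    of its boundary counts, and [p_* z] is a cycle. *)
Lemma total_fundamental_cycle :
  fundamental_cycle o (chain_map p z) -> param_fundamental_cycle o p total.
Proof.
move=> zfund; split; last by exists z; eexists; split=> //; exact: total_boundary.
have bB := @param_boundaryB R Mt Gam deck _ _ mu alpha n.
rewrite (morphBD bB) (morphB_sum bB) param_boundary_tens.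
rewrite (param_tens_one_eq0 puniv clsP deckP); last first.
  by rewrite -chain_map_boundary; exact: zfund.1.
rewrite add0r big1// => l _; rewrite param_boundary_tens.
rewrite (boundary_boundary (c l) : boundary (boundary (c l) : chain R n Mt) = 0).
exact: (tens0r (Linf_act alpha)).
Qed.

(** Coefficients can be read off the reduced expression: they are [fs.1] at the simplex [fs.2], and
    zero at the simplices of [s1], which lie in other orbits. *)
Lemma integral_abs_coef (s : seq (Linf mu * simplex R n Mt)) (s1 : seq (simplex R n Mt)) :
  uniq (map (push p) (map snd s ++ s1)) ->
  \sum_(fs <- s) tens fs.1 << fs.2 >> = total ->
  (\sum_(r <- map snd s ++ s1) integral_abs (coef r) = \sum_(fs <- s) integral_abs fs.1)%E.
Proof.
move=> us sE.
have coefE r : coef r = \sum_(fs <- s) simplex_coef act (Linf_act alpha) r fs.1 fs.2.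
  have [F [FB FE]] := @tensor_orbit_coef Gam _ _ act (push p)
    act1 actM act_free push_act act_transitive _ _
    (@Linf_actB _ _ _ _ _ alpha) (@Linf_actM _ _ _ _ _ alpha) r.
  have := congr1 F sE; rewrite (morphB_sum FB) (morphBD FB) (morphB_sum FB) !FE => E.
  symmetry; transitivity (\sum_(fs <- s) F (tens fs.1 << fs.2 >>)).
    by apply: eq_bigr => fs _; rewrite FE orbit_coefU.
  by rewrite E; congr (_ + _); apply: eq_bigr => l _; rewrite FE.
have us2 : uniq (map (push p \o snd) s).
  by move: us; rewrite map_cat cat_uniq => /and3P[us _ _]; rewrite map_comp.
have us0 : uniq s by exact: map_uniq us2.
rewrite big_cat /= [X in (_ + X)%E]big_seq [X in (_ + X)%E]big1 ?adde0 => [|r rs1].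
  rewrite big_map big_seq [RHS]big_seq; apply: eq_bigr => fs fss.
  congr integral_abs; rewrite coefE (bigD1_seq fs)//= big_seq_cond big1 ?addr0; last first.
    move=> fs' /andP[fs's ff]; rewrite /simplex_coef (transporter_none (h := push p))//.
    by move=> E; move/eqP: ff; apply; exact: (uniq_map_inj_in us2 _ _ (esym E)).
  rewrite /simplex_coef -[X in transporter _ _ X]act1 (transporter_act act1 actM act_free) /=.
  exact: Linf_act1.
rewrite coefE big_seq big1 => [|fs fss].
  rewrite -(morphB0 (@pi_LinfB _ _ _ mu)) integral_abs_pi; exact: L1norm0.
rewrite /simplex_coef (transporter_none (h := push p))//.
move=> E; move: us; rewrite map_cat cat_uniq => /and3P[_ /hasPn /(_ (push p r)) + _].
by rewrite map_f// E => /(_ isT)/negP; apply; rewrite -map_comp; exact: (map_f (push p \o snd)).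
Qed.

End Reduction.

Theorem corollary3p4 (R : realType)
  (n : nat) (M : topologicalType) (hM : closed_connected_manifold R n M)
  (o : orientation R n M)
  (Mt : topologicalType) (p : continuousType Mt M) (hp : universal_covering R p)
  (y0 : Mt) (Gam : groupType)
  (cls : {path (unit_itv R) from (p y0) to (p y0)} -> Gam)
  (hGam : is_fundamental_group cls)
  (deck : Gam -> continuousType Mt Mt) (hdeck : deck_action cls deck)
  (hinf : infinite_set [set: Gam])
  (dB : measure_display) (B : measurableType dB) (beta : probability B R)
  (hB : standard_borel R B) (hBnt : ~ exists b : B, beta [set b] = 1%E)
  (P : probability (bernoulli_space Gam B) R) (hP : product_measure beta P)
  (d : measure_display) (X : measurableType d) (mu : probability X R)
  (hX : standard_borel R X)
  (alpha : gamma_space Gam mu) (hfree : essentially_free alpha) :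
  (param_simplicial_volume o p deck alpha <=
   param_simplicial_volume o p deck (bernoulli_shift hP))%E.
Proof.
pose bern := bernoulli_shift hP.
apply: le_ereal_inf_tmp => _ [s [sred [_ [z [b [zfund sb]]]] ->]].
apply/lee_addgt0Pr => e e0.
have [ls bE] := tensor_sum_tens b.
pose g (l : Linf P * chain R n.+1 Mt) : ess_bounded P := repr l.1.
pose c (l : Linf P * chain R n.+1 Mt) := l.2.
have sE : \sum_(fs <- s) param_tens deck bern fs.1 << fs.2 >> =
    param_tens deck bern (Linf_one P) z +
    \sum_(l <- ls) param_tens deck bern (\pi_(Linf P) (g l)) (boundary (c l)).
  apply/eqP; rewrite addrC -subr_eq; apply/eqP.
  rewrite sb bE (morphB_sum (@param_boundaryB R Mt Gam deck _ _ P bern n.+1)).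
  by apply: eq_bigr => l _; rewrite [LHS]param_boundary_tens /g reprK.
have us0 : uniq (map (push p) (map snd s)) by rewrite -map_comp.
(* One list of representatives serves both actions: it starts with the simplices of the given cycle
   and covers [z] and all boundaries. *)
have [s1 [us rsP]] := @uniq_map_extend _ _ (push p) (map snd s)
  (dom z ++ flatten [seq dom (boundary (c l)) | l <- ls]) us0.
have [g' ineq] := @cycle_coef_transfer R n Mt Gam deck _ _ _ P hP _ _ _ alpha hX hfree
  hinf (map snd s ++ s1) _ ls z g c e e0.
pose coef := cycle_coef deck (Linf_act alpha) ls (Linf_one mu) z
  (fun l => \pi_(Linf mu) (g' l)) c.
(* The coefficients at these representatives give a reduced form of the new cycle over [alpha], so
   their total norm bounds the infimum from above. *)
apply: (@le_trans _ _ (\sum_(r <- map snd s ++ s1) integral_abs (coef r))%E).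
  apply: ereal_inf_lbound; exists [seq (coef r, r) | r <- map snd s ++ s1].
  rewrite !big_map; split=> //.
    by rewrite /reduced_form -map_comp.
  rewrite (cycle_coef_sum hp hGam hdeck) => //.
  - exact: (total_fundamental_cycle hp hGam hdeck).
  - by move=> s' s'z; apply: rsP; rewrite mem_cat s'z.
  - move=> l lls s' s'l; apply: rsP; rewrite mem_cat; apply/orP; right.
    by apply/flattenP; exists (dom (boundary (c l))) => //; exact: map_f.
rewrite -(integral_abs_coef hp hGam hdeck us sE).
under eq_bigr do rewrite integral_abs_cycle_coef.
under [X in (_ <= X + _)%E]eq_bigr do rewrite integral_abs_cycle_coef.
exact: ineq.
Qed.
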